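(* Let $X, X_1, X_2,\ldots$ be i.i.d. real random variables with distribution $F$ and mean $\mu$, let $\psi(\theta)=\log E[e^{\theta X}]$ and $\mathcal D=\{\theta:\psi(\theta)<\infty\}$. Let $b>\mu$ and $\gamma=bn$. Suppose that either $F$ is lattice with $0<P(X=b)<1$, or $F$ is non-lattice. Suppose $0\in\mathcal D^\circ$ and there is a unique $\theta^*\in\mathcal D^\circ$ with $\psi'(\theta^* )=b$. Let $u=u(n)$ be a truncation level for which there exists $\theta'>0$ with $\theta^*+\theta'\in\mathcal D^\circ$ and $\lim_{n\to\infty}ne^{-\theta' u}=0$. Then, as $n\to\infty$, $$p(\tilde F_u)-p(F)=o(p(F)).$$
   Context: $S_n=X_1+\cdots+X_n$. For a distribution $G$, $p(G)=P_G(S_n>\gamma)$ is the probability that $S_n>\gamma$ when $X_1,\ldots,X_n$ are i.i.d. with law $G$. The truncated distribution $\tilde F_u$ is $\tilde F_u(x)=F(x)/F(u)$ for $x\le u$ and $1$ for $x>u$. $\mathcal D^\circ$ is the interior of $\mathcal D$. $F$ is lattice if $(X-x_0)/h$ is a.s. an integer for some $x_0$ and $h>0$; the span is the largest such $h$. $a_n=o(b_n)$ means $a_n/b_n\to 0$. *)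

(* Defs.v *)
From HB Require Import structures.
From mathcomp Require Import all_boot all_order all_algebra.
From mathcomp Require Import all_classical all_reals all_analysis.
Set Implicit Arguments. Unset Strict Implicit. Unset Printing Implicit Defensive.
Import Order.TTheory GRing.Theory Num.Theory.
Import numFieldNormedType.Exports.
Local Open Scope classical_set_scope.
Local Open Scope ring_scope.

Section defs.
Context {R : realType}.

(* tail_iter mu g k s = P_mu( s + X_1 + ... + X_k > g ), X_i i.i.d. with law mu,
   written as the k-fold iterated integral (Tonelli). *)
Fixpoint tail_iter (mu : {measure set R -> \bar R}) (g : R) (k : nat) (s : R)
  : \bar R :=
  match k with
  | 0%N => (\1_[set x : R | g < x] s)%:E
  | k'.+1 => (\int[mu]_x tail_iter mu g k' (s + x))%E
  end.

Definition psum (mu : {measure set R -> \bar R}) (n : nat) (gamma : R) : R :=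
  fine (tail_iter mu gamma n 0).

Lemma trunc_const_ge0 (F : {measure set R -> \bar R}) (u : R) :
  0 <= (fine (F `]-oo, u]%classic))^-1.
Proof. by rewrite invr_ge0 fine_ge0 // measure_ge0. Qed.

Definition trunc_const (F : {measure set R -> \bar R}) (u : R) : {nonneg R} :=
  NngNum (trunc_const_ge0 F u).

Definition trunc (F : {measure set R -> \bar R}) (u : R)
  : {measure set R -> \bar R} :=
  mscale (trunc_const F u) (mrestr F (measurable_itv `]-oo, u])).

Definition mgf (F : {measure set R -> \bar R}) (t : R) : \bar R :=
  (\int[F]_x (expR (t * x))%:E)%E.

Definition cgf (F : {measure set R -> \bar R}) (t : R) : R :=
  ln (fine (mgf F t)).

Definition cgf_dom (F : {measure set R -> \bar R}) : set R :=
  [set t | (mgf F t < +oo)%E].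

Definition mean (F : {measure set R -> \bar R}) : R :=
  fine (\int[F]_x x%:E)%E.

Definition lattice (F : {measure set R -> \bar R}) : Prop :=
  exists x0 h : R, 0 < h /\
    F [set x | exists k : int, (x - x0) / h = k%:~R] = 1%E.

End defs.

(* Main.v *)
Require Import Defs.
From HB Require Import structures.
From mathcomp Require Import all_boot all_order all_algebra.
From mathcomp Require Import all_classical all_reals all_analysis.
From mathcomp Require Import measurable_realfun.
From mathcomp Require Import ring lra zify.
Import Order.TTheory GRing.Theory Num.Theory.
Import numFieldNormedType.Exports.
Local Open Scope classical_set_scope.
Local Open Scope ring_scope.

(* Tilting F by exp(th (x - b)), normalised, gives a law of mean b under which
   P(S_n > bn) is phi^n times E[exp(-th S); S > 0] for the centred sum S. The
   truncation error is at most of the order of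
   n P(X > u) P(S_n > bn) + n P(S_n > bn, X_1 > u), so it is enough
   to bound the tilted expectation with n - 1 summands, uniformly over
   the starting point, by a constant times the one with n summands started at
   0; the factor exp(-th' u) then comes from the first jump alone. Only the
   common order n^(-1/2) of both sides is needed, not its constant.

   For the comparison, write the tilted law as p A + q B with A, B probability
   laws, B supported in (b, b + K]. The n-fold convolution is then the
   binomial mixture of the A^(n-k) B^k. Summing over k telescopes:
   if BG - AG >= c g pointwise with 0 <= G <= 1, then
   sum_k A^(n-k) B^k g <= 1/c, so the mixture of the g-values is at most the
   largest binomial weight divided by c; G is a logistic function.
   Conversely if BH - AH <= C g with H the step function, the sum over
   |k - qn| <= c sqrt n of A^(n-k) B^k g is bounded below, since by Chernoff
   bounds H integrates to nearly 0 at the left end of this range and nearly 1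
   at its right end; and in this range all binomial weights are comparable
   with the largest one. *)

(** * Convolution operators given by densities with respect to [F] *)

Section weighted_convolution.
Set Implicit Arguments.
Unset Strict Implicit.
Context {R : realType} (F : probability R R) (b : R).
Implicit Types (w v : R -> R) (g h : R -> \bar R).
Local Open Scope ereal_scope.

Definition nonneg_meas g := measurable_fun setT g /\ forall s, 0 <= g s.

Definition weight w := measurable_fun setT w /\ forall x, (0 <= w x)%R.

(** Kernels are encoded as densities [w] against the fixed law [F], with steps centred at [b]. The
    original, truncated and tilted laws and the two mixture components then share one calculus; [w]
    may have any total mass. *)
Definition wconv w g (s : R) : \bar R :=
  \int[F]_x ((w x)%:E * g (s + (x - b))%R).

(** The normalisation [wexp F w (cst 1) = 1] expresses that [w] is a probability density. *)
Definition wexp w (h : R -> R) : \bar R := \int[F]_x (w x * h x)%:E.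

Lemma nonneg_meas_shift g (s : R) : nonneg_meas g ->
  measurable_fun setT (fun x : R => g (s + (x - b))%R).
Proof.
by move=> [mg _]; apply: measurableT_comp => //; apply: measurable_funD => //;
  apply: measurable_funD.
Qed.

Lemma measurable_wconv_integrand w g s : weight w -> nonneg_meas g ->
  measurable_fun setT (fun x : R => (w x)%:E * g (s + (x - b))%R).
Proof.
move=> [mw _] ng; apply: emeasurable_funM; first exact/measurable_EFinP.
exact: nonneg_meas_shift.
Qed.

Lemma wconv_integrand_ge0 w g s x : weight w -> nonneg_meas g ->
  0 <= (w x)%:E * g (s + (x - b))%R.
Proof. by move=> [_ w0] [_ g0]; rewrite mule_ge0// lee_fin. Qed.

#[local] Hint Resolve measurable_wconv_integrand wconv_integrand_ge0 : core.

Lemma nonneg_meas_wconv w g : weight w -> nonneg_meas g -> nonneg_meas (wconv w g).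
Proof.
move=> ww ng; split; last by move=> s; apply: integral_ge0 => x _; auto.
pose f (z : R * R) := (w z.2)%:E * g (z.1 + (z.2 - b))%R.
have mf : measurable_fun setT f.
  apply: emeasurable_funM.
    apply/measurable_EFinP; case: ww => mw _.
    exact: (measurableT_comp mw measurable_snd).
  case: ng => mg _; apply: (measurableT_comp mg).
  by apply: measurable_funD => //; apply: measurable_funD => //.
apply: (measurable_fun_fubini_tonelli_F (m2 := F) f mf).
by move=> [s x]; rewrite /f/=; auto.
Qed.

(** Tonelli, since the two shifts of the argument add up in either order. Commutation lets the two
    kinds of mixture step be sorted, and one large jump be moved to the front. *)
Lemma wconvC w v g : weight w -> weight v -> nonneg_meas g ->
  wconv w (wconv v g) = wconv v (wconv w g).
Proof.
move=> ww wv ng; apply/funext => s.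
pose f (z : R * R) := (w z.1)%:E * ((v z.2)%:E * g (s + (z.1 - b) + (z.2 - b))%R).
have mf : measurable_fun setT f.
  apply: emeasurable_funM.
    apply/measurable_EFinP; case: ww => mw _.
    exact: (measurableT_comp mw measurable_fst).
  apply: emeasurable_funM.
    apply/measurable_EFinP; case: wv => mv _.
    exact: (measurableT_comp mv measurable_snd).
  case: ng => mg _; apply: (measurableT_comp mg).
  apply: measurable_funD; last exact: measurable_funD.
  by apply: measurable_funD => //; apply: measurable_funD.
have f0 z : 0 <= f z.
  by rewrite /f; case: ww => _ w0; rewrite mule_ge0 ?lee_fin//; auto.
have wE x : (w x)%:E * wconv v g (s + (x - b))%R = \int[F]_y f (x, y).
  rewrite /f/= /wconv ge0_integralZl//; auto.
  by case: ww => _ w0; rewrite lee_fin.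
have vE y : (v y)%:E * wconv w g (s + (y - b))%R = \int[F]_x f (x, y).
  rewrite /f/= /wconv -ge0_integralZl//; auto; last first.
    by case: wv => _ v0; rewrite lee_fin.
  by apply: eq_integral => x _; rewrite muleCA (_ : s + (y - b) + (x - b) =
    s + (x - b) + (y - b))%R //; ring.
rewrite /wconv.
under eq_integral do rewrite wE.
under [RHS]eq_integral do rewrite vE.
exact: (fubini_tonelli (m1 := F) (m2 := F) f mf f0).
Qed.

Lemma le_wconv w g h : weight w -> nonneg_meas g -> nonneg_meas h ->
  (forall s, g s <= h s) -> forall s, wconv w g s <= wconv w h s.
Proof.
move=> ww ng nh gh s; apply: ge0_le_integral => //; auto.
by move=> x _; apply: lee_pmul => //; case: ww => _ w0; case: ng => _ g0;
  rewrite ?lee_fin.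
Qed.

Lemma le_wconvl w v g : weight w -> weight v -> nonneg_meas g ->
  (forall x, (w x <= v x)%R) -> forall s, wconv w g s <= wconv v g s.
Proof.
move=> ww wv ng wlev s; apply: ge0_le_integral => //; auto.
by move=> x _; apply: lee_wpmul2r; [case: ng|rewrite lee_fin].
Qed.

Lemma wconvD w g h s : weight w -> nonneg_meas g -> nonneg_meas h ->
  wconv w (g \+ h) s = wconv w g s + wconv w h s.
Proof.
move=> ww ng nh; rewrite /wconv -ge0_integralD//; auto.
by apply: eq_integral => x _; rewrite ge0_muleDr//; [case: ng|case: nh].
Qed.

Lemma wconvZ w k g s : (0 <= k)%R -> weight w -> nonneg_meas g ->
  wconv w (fun s => k%:E * g s) s = k%:E * wconv w g s.
Proof.
move=> k0 ww ng; rewrite /wconv -ge0_integralZl ?lee_fin//; auto.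
by apply: eq_integral => x _; rewrite muleCA.
Qed.

Lemma wconvDl w v (p q : R) g s : (0 <= p)%R -> (0 <= q)%R ->
  weight w -> weight v -> nonneg_meas g ->
  wconv (fun x => p * w x + q * v x)%R g s
  = p%:E * wconv w g s + q%:E * wconv v g s.
Proof.
move=> p0 q0 ww wv ng; rewrite /wconv -!ge0_integralZl ?lee_fin//; auto.
rewrite -ge0_integralD//; auto.
- apply: eq_integral => x _; rewrite EFinD !EFinM ge0_muleDl ?muleA//.
  + by case: ww => _ w0; rewrite mule_ge0 ?lee_fin.
  + by case: wv => _ v0; rewrite mule_ge0 ?lee_fin.
- by move=> x _; rewrite mule_ge0 ?lee_fin//; auto.
- by apply: emeasurable_funM => //; auto.
- by move=> x _; rewrite mule_ge0 ?lee_fin//; auto.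
- by apply: emeasurable_funM => //; auto.
Qed.

Lemma nonneg_measD g h : nonneg_meas g -> nonneg_meas h -> nonneg_meas (g \+ h).
Proof.
move=> [mg g0] [mh h0]; split; first exact: emeasurable_funD.
by move=> s; rewrite /= adde_ge0.
Qed.

Lemma nonneg_measZ k g : (0 <= k)%R -> nonneg_meas g ->
  nonneg_meas (fun s => k%:E * g s).
Proof.
move=> k0 [mg g0]; split; first exact: emeasurable_funM.
by move=> s; rewrite mule_ge0 ?lee_fin.
Qed.

Lemma nonneg_meas_EFin (f : R -> R) : weight f -> nonneg_meas (EFin \o f).
Proof.
by move=> [mf f0]; split; [exact/measurable_EFinP|move=> s; rewrite /= lee_fin].
Qed.

Lemma nonneg_meas_iter w n g : weight w -> nonneg_meas g ->
  nonneg_meas (iter n (wconv w) g).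
Proof. by move=> ww ng; elim: n => //= n; exact: nonneg_meas_wconv. Qed.

Lemma wconv_EFin w (f : R -> R) s :
  wconv w (EFin \o f) s = wexp w (fun x => f (s + (x - b))%R).
Proof. by apply: eq_integral => x _; rewrite EFinM. Qed.

Lemma iter_wconvC w v k g : weight w -> weight v -> nonneg_meas g ->
  iter k (wconv v) (wconv w g) = wconv w (iter k (wconv v) g).
Proof.
move=> ww wv ng; elim: k => //= k ->.
by rewrite wconvC//; exact: nonneg_meas_iter.
Qed.

Lemma le_iter_wconv w k g h : weight w -> nonneg_meas g -> nonneg_meas h ->
  (forall s, g s <= h s) ->
  forall s, iter k (wconv w) g s <= iter k (wconv w) h s.
Proof.
move=> ww ng nh gh; elim: k => //= k IH.
by apply: le_wconv => //; exact: nonneg_meas_iter.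
Qed.

Lemma iter_wconvD w k g h s : weight w -> nonneg_meas g -> nonneg_meas h ->
  iter k (wconv w) (g \+ h) s = iter k (wconv w) g s + iter k (wconv w) h s.
Proof.
move=> ww ng nh; elim: k s => //= k IH s; rewrite -wconvD//.
- by congr (wconv w _ s); apply/funext => t; exact: IH.
- exact: nonneg_meas_iter.
- exact: nonneg_meas_iter.
Qed.

Lemma iter_wconvZ w k c g s : (0 <= c)%R -> weight w -> nonneg_meas g ->
  iter k (wconv w) (fun s => c%:E * g s) s = c%:E * iter k (wconv w) g s.
Proof.
move=> c0 ww ng; elim: k s => //= k IH s; rewrite -wconvZ//.
- by congr (wconv w _ s); apply/funext => t; exact: IH.
- exact: nonneg_meas_iter.
Qed.

Lemma wconv_le_cst w g (c : R) s : weight w -> wexp w (cst 1%R) = 1 ->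
  nonneg_meas g -> (forall t, g t <= c%:E) -> wconv w g s <= c%:E.
Proof.
move=> ww w1 ng gc.
have c0 : (0 <= c)%R by case: ng => _ g0; rewrite -lee_fin (le_trans (g0 0%R)).
have nc : nonneg_meas (cst c%:E) by split=> // t; rewrite lee_fin.
apply: (le_trans (le_wconv ww ng nc gc s)).
rewrite /wconv -[leRHS]mul1e -w1 /wexp.
under eq_integral do rewrite muleC.
rewrite ge0_integralZl ?lee_fin//; last 2 first.
- by apply/measurable_EFinP; case: ww.
- by case: ww => _ w0 x _; rewrite lee_fin.
by rewrite muleC; under [in leRHS]eq_integral do rewrite mulr1.
Qed.

Lemma iter_wconv_le_cst w g (c : R) k s : weight w -> wexp w (cst 1%R) = 1 ->
  nonneg_meas g -> (forall t, g t <= c%:E) -> iter k (wconv w) g s <= c%:E.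
Proof.
move=> ww w1 ng gc; elim: k s => //= k IH s.
by apply: wconv_le_cst => //; exact: nonneg_meas_iter.
Qed.

(** Exponentials are eigenfunctions of every convolution; the eigenvalue is the moment generating
    function of the centred step. The Chernoff bounds for iterated kernels rest on this. *)
Lemma wconv_expR w (l : R) : weight w ->
  wconv w (fun s => (expR (l * s))%:E) =
  fun s => wexp w (fun x => expR (l * (x - b))) * (expR (l * s))%:E.
Proof.
move=> ww; apply/funext => s; rewrite /wconv /wexp muleC -ge0_integralZl//.
- by apply: eq_integral => x _; rewrite mulrDr expRD !EFinM muleCA.
- apply/measurable_EFinP; apply: measurable_funM; first by case: ww.
  apply: measurableT_comp => //; apply: measurable_funM => //.
  exact: measurable_funD.
- by case: ww => _ w0 x _; rewrite lee_fin mulr_ge0// expR_ge0.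
Qed.

End weighted_convolution.

(** * Expectations under a density *)

Section weighted_expectation.
Set Implicit Arguments.
Unset Strict Implicit.
Context {R : realType} (F : probability R R).
Implicit Types w v : R -> R.
Local Open Scope ereal_scope.

Lemma wexpE w (h : R -> R) : wexp F w h = wconv F 0 w (EFin \o h) 0.
Proof.
by rewrite wconv_EFin; apply: eq_integral => x _; congr (_ * h _)%:E; ring.
Qed.

Lemma wexpDl w v (p q : R) (h : R -> R) : (0 <= p)%R -> (0 <= q)%R ->
  weight w -> weight v -> weight h ->
  wexp F (fun x => p * w x + q * v x)%R h = p%:E * wexp F w h + q%:E * wexp F v h.
Proof. by move=> *; rewrite !wexpE wconvDl//; exact: nonneg_meas_EFin. Qed.

Lemma wexpD w (h1 h2 : R -> R) : weight w -> weight h1 -> weight h2 ->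
  wexp F w (fun x => h1 x + h2 x)%R = wexp F w h1 + wexp F w h2.
Proof. by move=> *; rewrite !wexpE -wconvD//; exact: nonneg_meas_EFin. Qed.

Lemma wexpZ w k (h : R -> R) : (0 <= k)%R -> weight w -> weight h ->
  wexp F w (fun x => k * h x)%R = k%:E * wexp F w h.
Proof. by move=> *; rewrite !wexpE -wconvZ//; exact: nonneg_meas_EFin. Qed.

(** Comparison is asked only where [w] is nonzero, so that the support of a density can be
    exploited. *)
Lemma le_wexp w (h1 h2 : R -> R) : weight w -> weight h1 -> weight h2 ->
  (forall x, (w x != 0 -> h1 x <= h2 x)%R) -> wexp F w h1 <= wexp F w h2.
Proof.
move=> [mw w0] [m1 h10] [m2 h20] h12; apply: ge0_le_integral => //.
- by move=> x _; rewrite lee_fin mulr_ge0.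
- by apply/measurable_EFinP; exact: measurable_funM.
- by apply/measurable_EFinP; exact: measurable_funM.
move=> x _; rewrite lee_fin; have [->|wx] := eqVneq (w x) 0%R.
  by rewrite !mul0r.
by rewrite ler_wpM2l// h12.
Qed.

Lemma wexp_ge0 w (h : R -> R) : weight w -> weight h -> 0 <= wexp F w h.
Proof.
by move=> [_ w0] [_ h0]; apply: integral_ge0 => x _; rewrite lee_fin mulr_ge0.
Qed.

Lemma wexp_cst w k : (0 <= k)%R -> weight w -> wexp F w (cst 1%R) = 1 ->
  wexp F w (cst k) = k%:E.
Proof.
move=> k0 ww w1; have wc : weight (cst 1%R : R -> R) by split=> //; exact: measurable_cst.
by rewrite -[RHS]mule1 -w1 -wexpZ//; apply: eq_integral => x _; rewrite mulr1.
Qed.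

Lemma weight_cst k : (0 <= k)%R -> weight (cst k : R -> R).
Proof. by split=> //; exact: measurable_cst. Qed.

Lemma weight_expR (l a : R) : weight (fun x => expR (l * (x - a)) : R).
Proof.
split; last by move=> x; exact: expR_ge0.
apply: measurableT_comp => //; apply: measurable_funM => //.
exact: measurable_funD.
Qed.

End weighted_expectation.

(** * Binomial weights near their mode *)

Section binomial_weights.
Set Implicit Arguments.
Unset Strict Implicit.
Context {R : realType} (p q : R).

Definition binw (m k : nat) : R := 'C(m, k)%:R * p ^+ (m - k) * q ^+ k.

Lemma binw_small m k : (m < k)%N -> binw m k = 0.
Proof. by move=> mk; rewrite /binw bin_small// !mul0r. Qed.

Lemma binwSS m k : binw m.+1 k.+1 = p * binw m k.+1 + q * binw m k.
Proof.
rewrite /binw binS natrD subSS exprS; have [km|mk] := ltnP k m.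
  by rewrite (_ : m - k = (m - k.+1).+1)%N ?exprS; [ring|lia].
by rewrite [in 'C(m, k.+1)]bin_small ?ltnS//; ring.
Qed.

Lemma binwS0 m : binw m.+1 0 = p * binw m 0.
Proof. by rewrite /binw !bin0 !subn0 exprS; ring. Qed.

(** Pascal's rule in abstract form: [i] and [j] count the steps of each kind already taken, and
    every unit of [m] is resolved into one of the two kinds. *)
Lemma binw_expand (t : nat -> nat -> nat -> R) :
  (forall m i j, t m.+1 i j = p * t m i.+1 j + q * t m i j.+1) ->
  forall m i j, t m i j = \sum_(k < m.+1) binw m k * t 0 (i + m - k)%N (j + k)%N.
Proof.
move=> tS; elim=> [|m IH] i j.
  by rewrite big_ord1 /binw bin0 !expr0 !mul1r addn0 subn0 addn0.
rewrite tS !IH [RHS]big_ord_recl binwS0.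
pose u k := t 0 (i + m.+1 - k)%N (j + k)%N.
have -> : \sum_(k < m.+1) binw m k * t 0 (i.+1 + m - k)%N (j + k)%N =
    binw m 0 * u 0 + \sum_(k < m.+1) binw m k.+1 * u k.+1.
  transitivity (\sum_(k < m.+2) binw m k * u k); last by rewrite big_ord_recl.
  rewrite [RHS]big_ord_recr/= (@binw_small m m.+1)// mul0r addr0.
  by apply: eq_bigr => k _; rewrite /u addSnnS.
have -> : \sum_(k < m.+1) binw m.+1 (lift ord0 k) *
      t 0 (i + m.+1 - lift ord0 k)%N (j + lift ord0 k)%N =
    p * (\sum_(k < m.+1) binw m k.+1 * u k.+1) +
    q * \sum_(k < m.+1) binw m k * u k.+1.
  rewrite !mulr_sumr -big_split/=; apply: eq_bigr => k _.
  by rewrite /lift/= /bump/= add1n binwSS -/(u k.+1); ring.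
rewrite mulrDr -!addrA mulrA; congr (_ + (_ + _)).
by congr (_ * _); apply: eq_bigr => k _; rewrite /u addnS subSS addSnnS.
Qed.

Hypotheses (p0 : 0 < p) (q0 : 0 < q) (pq1 : p + q = 1).

Lemma binw_ge0 m k : 0 <= binw m k.
Proof. by rewrite /binw !mulr_ge0// exprn_ge0// ltW. Qed.

(** The ratio of consecutive weights is [q (m - k) / (p (k + 1))]. Written without division and
    around the centre, it shows that the sign of [q (m + 1) - (k + 1)] decides monotonicity. *)
Lemma binw_ratio m k : (k <= m)%N ->
  binw m k.+1 * (k.+1%:R * p) = binw m k * (k.+1%:R * p + (q * m.+1%:R - k.+1%:R)).
Proof.
move=> km.
have -> : k.+1%:R * p + (q * m.+1%:R - k.+1%:R) = (m - k)%:R * q :> R.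
  have -> : p = 1 - q by rewrite -pq1 addrK.
  by rewrite -subSS natrB ?ltnS//; ring.
rewrite /binw; have [->|km'] := eqVneq k m.
  by rewrite bin_small// subnn; ring.
have {}km : (k < m)%N by rewrite ltn_neqAle km' km.
rewrite (_ : (m - k) = (m - k.+1).+1)%N; last by lia.
rewrite [p ^+ _.+1]exprS exprS.
have : k.+1%:R * 'C(m, k.+1)%:R = (m - k)%:R * 'C(m, k)%:R :> R.
  by rewrite -!natrM mul_bin_left.
rewrite (_ : (m - k) = (m - k.+1).+1)%N; last by lia.
set a := 'C(m, k.+1)%:R; set c := 'C(m, k)%:R.
set x := p ^+ _; set y := q ^+ _ => e.
transitivity (k.+1%:R * a * x * q * y * p); first by ring.
by rewrite e; ring.
Qed.

Lemma binw_le_left m k : (k <= m)%N -> k.+1%:R <= q * m.+1%:R ->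
  binw m k <= binw m k.+1.
Proof.
move=> km kq; have kp : 0 < k.+1%:R * p by rewrite mulr_gt0.
rewrite -(ler_pM2r kp) binw_ratio// ler_wpM2l ?binw_ge0// lerDl subr_ge0//.
Qed.

Lemma binw_le_right m k : q * m.+1%:R <= k.+1%:R -> binw m k.+1 <= binw m k.
Proof.
have [km|mk] := leqP k m; 
  last by rewrite (@binw_small m k.+1) ?binw_ge0// ltnW.
move=> kq; have kp : 0 < k.+1%:R * p by rewrite mulr_gt0.
rewrite -(ler_pM2r kp) binw_ratio// ler_wpM2l ?binw_ge0// gerDl subr_le0//.
Qed.

(** The weights rise up to the integer part of [q (m + 1)] and fall afterwards. *)
Lemma binw_le_mode m k j : (k <= m)%N -> k%:R <= q * m.+1%:R < k.+1%:R ->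
  binw m j <= binw m k.
Proof.
move=> km /andP[k1 k2]; have [jk|kj] := leqP j k.
  have H d : (d <= k)%N -> binw m (k - d) <= binw m k.
    elim: d => [|d IH] dk; first by rewrite subn0.
    apply: le_trans (IH (ltnW dk)).
    rewrite (_ : k - d = (k - d.+1).+1)%N; last by lia.
    apply: binw_le_left; first by lia.
    by apply: le_trans k1; rewrite ler_nat; lia.
  by rewrite -(subKn jk); apply: H; exact: leq_subr.
have H d : binw m (k + d) <= binw m k.
  elim: d => [|d IH]; first by rewrite addn0.
  apply: le_trans IH; rewrite addnS; apply: binw_le_right.
  by apply/ltW/(lt_le_trans k2); rewrite ler_nat; lia.
by rewrite -(subnKC (ltnW kj)); exact: H.
Qed.

(** In [binw_ratio] the deviation from the centre is at most [c r], while [(k + 1) p] and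
    [(m - k) q] are at least [p q r^2 / 2]; hence neighbouring weights differ by a factor
    [1 + O(1 / r)]. *)
Lemma binw_step (c r : R) m k : 0 < c -> 0 < r -> r ^+ 2 = m.+1%:R ->
  2 * c <= p * r -> 2 * c <= q * r ->
  `|k.+1%:R - q * m.+1%:R| <= c * r ->
  [/\ (k <= m)%N, binw m k.+1 <= (1 + 2 * c / (p * q * r)) * binw m k &
      binw m k <= (1 + 2 * c / (p * q * r)) * binw m k.+1].
Proof.
move=> c0 r0 rE cp cq; rewrite ler_distl => /andP[k1 k2].
have qE : q = 1 - p by rewrite -pq1 addrAC subrr add0r.
have cr1 : 2 * c * r <= p * r ^+ 2 by rewrite expr2 mulrA ler_pM2r.
have cr2 : 2 * c * r <= q * r ^+ 2 by rewrite expr2 mulrA ler_pM2r.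
have r20 : 0 < r ^+ 2 by rewrite exprn_gt0.
have kl : q * r ^+ 2 / 2 <= k.+1%:R by rewrite -rE in k1; lra.
have kr : p * r ^+ 2 / 2 <= m.+1%:R - k.+1%:R.
  by rewrite -rE in k2 *; move: k2; rewrite qE; lra.
have km : (k <= m)%N.
  rewrite -ltnS -(ltr_nat R); have : 0 < p * r ^+ 2 by rewrite mulr_gt0.
  by move: kr; lra.
have e0 : 0 < p * q * r by rewrite !mulr_gt0.
have key : c * r <= 2 * c / (p * q * r) * (q * r ^+ 2 / 2 * p).
  by rewrite [leRHS](_ : _ = c * r)//; field; rewrite !gt_eqF.
have key2 : c * r <= 2 * c / (p * q * r) * (p * r ^+ 2 / 2 * q).
  by rewrite [leRHS](_ : _ = c * r)//; field; rewrite !gt_eqF.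
have e1 : 0 <= 2 * c / (p * q * r) by rewrite divr_ge0// ltW// mulr_gt0.
set e := 2 * c / _ in e1 key key2 *.
have ratio := binw_ratio km.
have kp : 0 < k.+1%:R * p by rewrite mulr_gt0.
have wk := binw_ge0 m k; have wk1 := binw_ge0 m k.+1.
split => //.
  rewrite -(ler_pM2r kp) ratio [leRHS]mulrAC [leRHS]mulrC ler_wpM2l//.
  rewrite mulrDl mul1r lerD2l.
  apply: (@le_trans _ _ (c * r)); first by lra.
  apply: le_trans key _; rewrite ler_wpM2l// ler_pM2r//.
have kq : 0 < k.+1%:R * p + (q * m.+1%:R - k.+1%:R).
  rewrite (_ : _ + _ = (m.+1%:R - k.+1%:R) * q); last by rewrite qE; ring.
  by rewrite mulr_gt0// (lt_le_trans _ kr)// divr_gt0// mulr_gt0.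
rewrite -(ler_pM2r kq) -ratio [leRHS]mulrAC [leRHS]mulrC ler_wpM2l//.
rewrite (_ : k.+1%:R * p + _ = (m.+1%:R - k.+1%:R) * q); last by rewrite qE; ring.
rewrite mulrDl mul1r.
rewrite (_ : k.+1%:R * p = (m.+1%:R - k.+1%:R) * q + (k.+1%:R - q * m.+1%:R)); last first.
  by rewrite qE; ring.
rewrite lerD2l; apply: (@le_trans _ _ (c * r)); first by lra.
by apply: le_trans key2 _; rewrite ler_wpM2l// ler_pM2r.
Qed.

(** A window of width [2 c r] is crossed in at most [2 c r] steps, each costing a factor
    [1 + 2 c / (p q r)]; the product stays below [exp(4 c^2 / (p q))], whatever [m] is. *)
Lemma binw_window (c : R) : 0 < c -> exists2 C : R, 0 < C & exists N : nat,
  forall m, (N <= m)%N -> forall k j,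
  `|k%:R - q * m.+1%:R| <= c * Num.sqrt m.+1%:R -> binw m j <= C * binw m k.
Proof.
move=> c0; exists (expR (4 * c ^+ 2 / (p * q))); first exact: expR_gt0.
(* The first two terms give the hypotheses of [binw_step]; the third puts the mode inside the
   window. *)
pose r0 := 2 * c / p + 2 * c / q + c^-1.
have r00 : 0 < r0 by rewrite !addr_gt0 ?divr_gt0 ?mulr_gt0 ?invr_gt0.
exists (Num.truncn (r0 ^+ 2)) => m Nm k j.
set r := Num.sqrt _ => kw.
have rE : r ^+ 2 = m.+1%:R by rewrite sqr_sqrtr.
have r1 : r0 <= r.
  rewrite -(@ler_sqr _ r0 r) ?nnegrE ?ltW// ?sqrtr_gt0//.
  rewrite rE; apply: (lt_le_trans (truncnS_gt (r0 ^+ 2))).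
  by rewrite ler_nat ltnS.
have rp : 0 < r by rewrite (lt_le_trans _ r1).
have h1 : 2 * c <= p * r.
  rewrite [leRHS]mulrC -ler_pdivrMr//; apply: le_trans r1.
  by rewrite /r0 -addrA lerDl addr_ge0// ?invr_ge0 ?divr_ge0// ?mulr_ge0// ltW.
have h2 : 2 * c <= q * r.
  rewrite [leRHS]mulrC -ler_pdivrMr//; apply: le_trans r1.
  by rewrite /r0 addrAC lerDr addr_ge0// ?invr_ge0 ?divr_ge0// ?mulr_ge0// ltW.
have h3 : 1 <= c * r.
  rewrite [leRHS]mulrC -ler_pdivrMr// div1r; apply: le_trans r1.
  by rewrite /r0 lerDr addr_ge0// ?divr_ge0// ?mulr_ge0// ltW.
pose e := 2 * c / (p * q * r).
have e0 : 0 <= e by rewrite /e divr_ge0 ?ltW// !mulr_gt0.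
have inwin a : a <= c * r -> - (c * r) <= a -> `|a| <= c * r.
  by move=> *; rewrite ler_norml; apply/andP.
have chain d i : `|i%:R - q * m.+1%:R| <= c * r ->
    `|(i + d)%:R - q * m.+1%:R| <= c * r ->
    binw m (i + d) <= (1 + e) ^+ d * binw m i /\
    binw m i <= (1 + e) ^+ d * binw m (i + d).
  elim: d => [|d IH] iw idw; first by rewrite addn0 expr0 !mul1r.
  have idw' : `|(i + d)%:R - q * m.+1%:R| <= c * r.
    move: iw idw; rewrite !ler_norml addnS -natr1 natrD => /andP[a1 a2] /andP[b1 b2].
    have d0 : 0 <= d%:R :> R by []. by apply/andP; split; lra.
  have [IH1 IH2] := IH iw idw'.
  rewrite addnS in idw *.
  have [_ s1 s2] := binw_step c0 rp rE h1 h2 idw.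
  have e1 : 0 <= 1 + e by rewrite addr_ge0.
  rewrite exprS; split.
    by rewrite -mulrA; apply: le_trans s1 _; rewrite ler_wpM2l.
  rewrite [(1 + e) * _]mulrC -mulrA; apply: le_trans IH2 _.
  by rewrite ler_wpM2l// exprn_ge0.
have bound d i : `|i%:R - q * m.+1%:R| <= c * r ->
    `|(i + d)%:R - q * m.+1%:R| <= c * r ->
    (1 + e) ^+ d <= expR (4 * c ^+ 2 / (p * q)).
  move=> iw idw; apply: (@le_trans _ _ (expR e ^+ d)).
    by rewrite lerXn2r ?nnegrE ?addr_ge0 ?expR_ge0// expR_ge1Dx.
  rewrite -expRM_natl ler_expR.
  have dr : d%:R <= 2 * c * r.
    by move: iw idw; rewrite !ler_norml natrD => /andP[a1 a2] /andP[b1 b2]; lra.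
  rewrite mulr_natl -mulr_natr.
  apply: (@le_trans _ _ (e * (2 * c * r))); first by rewrite ler_wpM2l.
  by rewrite /e le_eqVlt; apply/orP; left; apply/eqP; field; rewrite !gt_eqF.
have compare i i' : `|i%:R - q * m.+1%:R| <= c * r ->
    `|i'%:R - q * m.+1%:R| <= c * r ->
    binw m i <= expR (4 * c ^+ 2 / (p * q)) * binw m i'.
  move=> iw iw'; have [ii'|/ltnW ii'] := leqP i i'.
    rewrite -(subnKC ii') in iw' *; have [_ h] := chain _ _ iw iw'.
    by apply: le_trans h _; rewrite ler_wpM2r ?binw_ge0// (bound _ _ iw iw').
  rewrite -(subnKC ii') in iw *; have [h _] := chain _ _ iw' iw.
  by apply: le_trans h _; rewrite ler_wpM2r ?binw_ge0// (bound _ _ iw' iw).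
have n0 : 0 <= q * m.+1%:R by rewrite mulr_ge0// ltW.
(* The mode dominates every weight and, since [1 <= c r], lies in the window, where [compare]
   applies. *)
pose k0 := Num.truncn (q * m.+1%:R).
have /andP[k01 k02] : k0%:R <= q * m.+1%:R < k0.+1%:R by exact: truncn_itv.
have k0w : `|k0%:R - q * m.+1%:R| <= c * r.
  by apply: inwin; move: k02; rewrite -natr1; lra.
have k0m : (k0 <= m)%N.
  rewrite -ltnS -(ltr_nat R); apply: le_lt_trans k01 _.
  by rewrite gtr_pMl// -pq1 ltrDr.
apply: le_trans (compare _ _ k0w kw).
by apply: binw_le_mode => //; apply/andP.
Qed.

End binomial_weights.

(** * The logistic function as a smooth step *)

Section logistic.
Set Implicit Arguments.
Unset Strict Implicit.
Context {R : realType}.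
Implicit Types s y : R.

Definition logistic s : R := expR s / (1 + expR s).
Definition logistic' s : R := expR s / (1 + expR s) ^+ 2.

Lemma logistic_ge0 s : 0 <= logistic s.
Proof. by rewrite divr_ge0 ?addr_ge0 ?expR_ge0. Qed.

Lemma logistic_le1 s : logistic s <= 1.
Proof. by rewrite ler_pdivrMr ?mul1r ?lerDr// addr_gt0 ?expR_gt0. Qed.

Lemma logistic'_ge0 s : 0 <= logistic' s.
Proof. by rewrite divr_ge0 ?exprn_ge0 ?addr_ge0 ?expR_ge0. Qed.

Lemma logistic'_le1 s : logistic' s <= 1.
Proof.
have e0 := expR_gt0 s; rewrite ler_pdivrMr ?exprn_gt0 ?addr_gt0//.
by rewrite mul1r; nra.
Qed.

(** The factor 4 comes from [1 + exp s <= 2 exp s] for [s >= 0]. *)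
Lemma logistic'_ge s : 0 <= s -> expR (- s) <= 4 * logistic' s.
Proof.
move=> s0; rewrite expRN /logistic'; have := expR_ge1Dx s.
set E := expR s => E1; have {}E1 : 1 <= E by lra.
have E0 : 0 < E by lra.
rewrite mulrA ler_pdivlMr ?exprn_gt0 ?addr_gt0// mulrC ler_pdivrMr//.
by nra.
Qed.

(** The increment factors exactly through the derivative [logistic'], with
    [z = (Y - 1) (1 + E) / (1 + E Y)] for [E = exp s], [Y = exp y]. Both bounds on [z] come from
    [(Y - 1)^2 >= 0] and do not involve [s], so they can be integrated in [y]. *)
Lemma logistic_diff s y : exists2 z,
    1 - expR (- y) <= z <= expR y - 1 &
  logistic (s + y) = logistic s + logistic' s * z.
Proof.
have E0 := expR_gt0 s; have Y0 := expR_gt0 y.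
exists ((expR y - 1) * (1 + expR s) / (1 + expR s * expR y)); last first.
  rewrite /logistic /logistic' expRD; set E := expR s in E0 *.
  set Y := expR y in Y0 *.
  have : 0 < E * Y by rewrite mulr_gt0.
  by move=> EY0; field; rewrite !gt_eqF ?addr_gt0.
rewrite expRN; set E := expR s in E0 *; set Y := expR y in Y0 *.
have EY : 0 < 1 + E * Y by rewrite addr_gt0// mulr_gt0.
apply/andP; split.
  rewrite ler_pdivlMr// (_ : 1 - Y^-1 = (Y - 1) / Y); last by field; rewrite gt_eqF.
  rewrite mulrAC ler_pdivrMr//.
  have : 0 <= (Y - 1) ^+ 2 by rewrite sqr_ge0.
  by nra.
rewrite ler_pdivrMr//.
have : 0 <= (Y - 1) ^+ 2 * E by rewrite mulr_ge0 ?sqr_ge0// ltW.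
by nra.
Qed.

End logistic.

(** * Powers of two commuting kernels and of their mixture *)

Definition wconv2 {R : realType} (F : probability R R) (b : R) (wA wB : R -> R)
    (i k : nat) (g : R -> \bar R) : R -> \bar R :=
  iter i (wconv F b wA) (iter k (wconv F b wB) g).

Section two_weights.
Set Implicit Arguments.
Unset Strict Implicit.
Context {R : realType} (F : probability R R) (b p q : R) (wA wB : R -> R).
Hypotheses (p0 : 0 < p) (q0 : 0 < q) (pq1 : p + q = 1).
Hypotheses (wwA : weight wA) (wwB : weight wB).
Hypotheses (wA1 : wexp F wA (cst 1) = 1%E) (wB1 : wexp F wB (cst 1) = 1%E).

Local Notation A := (wconv F b wA).
Local Notation B := (wconv F b wB).
Local Notation wT := (fun x => p * wA x + q * wB x).
Local Notation T := (wconv F b wT).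
Local Notation AB := (wconv2 F b wA wB).

Lemma weight_mix : weight wT.
Proof.
case: wwA wwB => mA A0 [mB B0]; split.
  by apply: measurable_funD; apply: measurable_funM.
by move=> x; rewrite addr_ge0// mulr_ge0// ltW.
Qed.
Let wwT := weight_mix.

Lemma nonneg_meas_wconv2 i k g : nonneg_meas g -> nonneg_meas (AB i k g).
Proof. by move=> ng; do 2 apply: nonneg_meas_iter => //. Qed.
Let nAB := nonneg_meas_wconv2.

Lemma wconv2_le_cst i k g (c : R) s : nonneg_meas g ->
  (forall t, g t <= c%:E)%E -> (AB i k g s <= c%:E)%E.
Proof.
move=> ng gc; apply: iter_wconv_le_cst => //; first exact: nonneg_meas_iter.
by move=> t; exact: iter_wconv_le_cst.
Qed.

Lemma wconv2_fin_num i k g (c : R) s : nonneg_meas g ->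
  (forall t, g t <= c%:E)%E -> AB i k g s \is a fin_num.
Proof.
move=> ng gc; rewrite ge0_fin_numE; last exact: (nAB i k ng).2.
by rewrite (le_lt_trans (wconv2_le_cst i k s ng gc))// ltry.
Qed.

Lemma wconv2_ge0 i k g s : nonneg_meas g -> 0 <= fine (AB i k g s).
Proof. by move=> ng; rewrite fine_ge0//; exact: (nAB i k ng).2. Qed.

Lemma le_wconv2 i k g h s : nonneg_meas g -> nonneg_meas h ->
  (forall t, g t <= h t)%E -> (AB i k g s <= AB i k h s)%E.
Proof.
move=> ng nh gh; apply: le_iter_wconv => //; try exact: nonneg_meas_iter.
by move=> t; exact: le_iter_wconv.
Qed.

Lemma wconv2D i k g h s : nonneg_meas g -> nonneg_meas h ->
  AB i k (fun t => g t + h t)%E s = (AB i k g s + AB i k h s)%E.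
Proof.
move=> ng nh; rewrite /wconv2 -iter_wconvD//; try exact: nonneg_meas_iter.
by congr (iter i _ _ s); apply/funext => t; exact: iter_wconvD.
Qed.

Lemma wconv2Z i k (c : R) g s : 0 <= c -> nonneg_meas g ->
  AB i k (fun t => c%:E * g t)%E s = (c%:E * AB i k g s)%E.
Proof.
move=> c0 ng; rewrite /wconv2 -iter_wconvZ//; try exact: nonneg_meas_iter.
by congr (iter i _ _ s); apply/funext => t; exact: iter_wconvZ.
Qed.

Lemma wconv2A i k g : nonneg_meas g -> AB i k (A g) = AB i.+1 k g.
Proof. by move=> ng; rewrite /wconv2 iter_wconvC// -iterSr. Qed.

Lemma wconv2B i k g : AB i k (B g) = AB i k.+1 g.
Proof. by rewrite /wconv2 -iterSr. Qed.

Lemma wexp_mix1 : wexp F wT (cst 1) = 1%E.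
Proof.
rewrite wexpDl ?ltW//.
by rewrite wA1 wB1 !mule1 -EFinD pq1.
Qed.

(** Binomial formula for the powers of [p A + q B], valid because [A] and [B] commute. The bound on
    [g] keeps all terms finite, so that [fine] is additive. *)
Lemma iter_mix_binw g (c : R) m s : nonneg_meas g -> (forall t, g t <= c%:E)%E ->
  fine (iter m T g s) = \sum_(k < m.+1) binw p q m k * fine (AB (m - k) k g s).
Proof.
move=> ng gc.
have wT1 := wexp_mix1.
pose t m i j := fine (iter m T (AB i j g) s).
have tfin n i j : iter n T (AB i j g) s \is a fin_num.
  rewrite ge0_fin_numE; 
    last by have [_] := @nonneg_meas_iter R F b wT n _ wwT (nAB i j ng); exact.
  rewrite (@le_lt_trans _ _ c%:E) ?ltry//.
  apply: iter_wconv_le_cst => //; first exact: nAB.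
  by move=> u; exact: wconv2_le_cst.
have tS n i j : t n.+1 i j = p * t n i.+1 j + q * t n i j.+1.
  rewrite /t iterSr.
  have -> : T (AB i j g) =
      ((fun u => p%:E * AB i.+1 j g u) \+ (fun u => q%:E * AB i j.+1 g u))%E.
    apply/funext => u; rewrite wconvDl ?ltW//; last exact: nAB.
    congr (_ * _ + _ * _)%E; rewrite /wconv2.
    by rewrite -iter_wconvC//;
      exact: nonneg_meas_iter.
  rewrite iter_wconvD//; try by apply: nonneg_measZ; rewrite ?ltW//; exact: nAB.
  rewrite !iter_wconvZ ?ltW//; try exact: nAB.
  by rewrite fineD ?fineM ?fin_numM.
have -> : iter m T g s = iter m T (AB 0 0 g) s by [].
rewrite -/(t m 0%N 0%N) (binw_expand tS).
by apply: eq_bigr => k _; rewrite !add0n.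
Qed.

(** Each factor multiplies the exponential by its eigenvalue, which is at most [exp a1] or
    [exp a2]. *)
Lemma wconv2_expR i k (l a1 a2 : R) s :
  (wexp F wA (fun x => expR (l * (x - b))) <= (expR a1)%:E)%E ->
  (wexp F wB (fun x => expR (l * (x - b))) <= (expR a2)%:E)%E ->
  (AB i k (fun t => (expR (l * t))%:E) s
     <= (expR (i%:R * a1 + k%:R * a2 + l * s))%:E)%E.
Proof.
move=> hA hB.
have nE : nonneg_meas (fun t => (expR (l * t))%:E).
  split; last by move=> t; rewrite lee_fin expR_ge0.
  by apply/measurable_EFinP; apply: measurableT_comp => //; exact: measurable_funM.
(* A single kernel, with a constant [c] in the exponent for what earlier factors contributed; it is
   used for [B] and then for [A]. *)
have step w a n h c : weight w ->
    (wexp F w (fun x => expR (l * (x - b))) <= (expR a)%:E)%E -> nonneg_meas h ->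
    (forall t, h t <= (expR (c + l * t))%:E)%E ->
    forall t, (iter n (wconv F b w) h t <= (expR (n%:R * a + c + l * t))%:E)%E.
  move=> ww hw nh hh; elim: n => [|n IH] t; first by rewrite mul0r add0r.
  have ex0 x : (0 <= (expR x)%:E)%E by rewrite lee_fin expR_ge0.
  apply: (@le_trans _ _ (wconv F b w
      (fun t => (expR (n%:R * a + c))%:E * (expR (l * t))%:E)%E t)).
    apply: le_wconv => //; [exact: nonneg_meas_iter|exact: nonneg_measZ (expR_ge0 _) nE|].
    by move=> u; rewrite -EFinM -expRD; exact: IH.
  rewrite wconvZ ?expR_ge0// wconv_expR//.
  apply: (@le_trans _ _ ((expR (n%:R * a + c))%:E * ((expR a)%:E * (expR (l * t))%:E))%E).
    by rewrite lee_wpmul2l// lee_wpmul2r.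
  by rewrite -!EFinM -!expRD lee_fin ler_expR -natr1; lra.
apply: (@step wA a1 i _ (k%:R * a2) wwA hA); first exact: nonneg_meas_iter.
move=> t; rewrite -[k%:R * a2]addr0.
by apply: (@step wB a2 k _ 0 wwB hB nE) => u; rewrite add0r.
Qed.

Lemma wconv2_cst1 i k s : AB i k (cst 1%E) s = 1%E.
Proof.
have c1 w : weight w -> wexp F w (cst 1) = 1%E -> forall n,
    iter n (wconv F b w) (cst 1%E) = cst 1%E.
  move=> ww w1; elim=> //= n ->; apply/funext => t; rewrite -[RHS]w1.
  by apply: eq_integral => x _; rewrite mule1 mulr1.
by rewrite /wconv2 !c1.
Qed.

End two_weights.

(** * The half-line indicator and its exponentially damped version *)

Section exponential_tail.
Set Implicit Arguments.
Unset Strict Implicit.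
Context {R : realType}.

Definition step (s : R) : R := \1_[set x : R | 0 < x] s.

Lemma step_pos s : 0 < s -> step s = 1.
Proof. by move=> s0; rewrite /step indicE mem_set. Qed.

Lemma step_npos s : s <= 0 -> step s = 0.
Proof. by move=> s0; rewrite /step indicE memNset//= ltNge s0. Qed.

Lemma step_01 s : 0 <= step s <= 1.
Proof. by have [/step_npos->|/step_pos->] := leP s 0; rewrite ler01 lexx. Qed.

Lemma weight_step : weight step.
Proof.
split; last by move=> s; case/andP: (step_01 s).
apply: measurable_indic; rewrite -[X in measurable X](_ : `]0, +oo[%classic = _).
  exact: measurable_itv.
by apply/seteqP; split => x /=; rewrite in_itv/= andbT.
Qed.

(** The integrand left after tilting by [th]: its tilted expectation is [E[exp(-th S); S > 0]]. *)
Definition exp_tail (th s : R) : R := expR (- (th * s)) * step s.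

Lemma weight_exp_tail th : weight (exp_tail th).
Proof.
have [ms s0] := weight_step.
split; last by move=> s; rewrite mulr_ge0// expR_ge0.
apply: measurable_funM => //; apply: measurableT_comp => //.
by apply: measurableT_comp => //; exact: measurable_funM.
Qed.

Lemma exp_tail_le1 th s : 0 <= th -> exp_tail th s <= 1.
Proof.
move=> th0; rewrite /exp_tail; have [/step_npos->|s0] := leP s 0.
  by rewrite mulr0.
by rewrite step_pos// mulr1 -expR0 ler_expR oppr_le0 mulr_ge0// ltW.
Qed.

End exponential_tail.

(** * Comparison of m and m + 1 steps of a centred mixture *)

Section local_comparison.
Set Implicit Arguments.
Unset Strict Implicit.
Context {R : realType} (F : probability R R) (b p q th K CA l0 C2 D : R).
Context (wA wB : R -> R).
Hypotheses (p0 : 0 < p) (q0 : 0 < q) (pq1 : p + q = 1).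
Hypotheses (wwA : weight wA) (wwB : weight wB).
Hypotheses (wA1 : wexp F wA (cst 1) = 1%E) (wB1 : wexp F wB (cst 1) = 1%E).
Hypotheses (th0 : 0 < th) (l00 : 0 < l0) (C20 : 0 < C2) (D0 : 0 < D).
Hypothesis wBK : forall x, wB x != 0 -> b < x <= b + K.
Hypothesis wACA : (wexp F wA (fun x => expR (- th * (x - b))) <= CA%:E)%E.
(* A has mean - q D and B has mean p D, so that the mixture is centred. *)
Hypothesis mgfA : forall l, `|l| <= l0 ->
  (wexp F wA (fun x => expR (l * (x - b))) <= (expR (- (l * q * D) + C2 * l ^+ 2))%R%:E)%E.
Hypothesis mgfB : forall l, `|l| <= l0 ->
  (wexp F wB (fun x => expR (l * (x - b))) <= (expR (l * p * D + C2 * l ^+ 2))%R%:E)%E.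

Local Notation A := (wconv F b wA).
Local Notation B := (wconv F b wB).
Local Notation wT := (fun x => p * wA x + q * wB x).
Local Notation T := (wconv F b wT).
Local Notation AB := (wconv2 F b wA wB).
Let f := EFin \o exp_tail th.
Let H : R -> \bar R := EFin \o @step R.

Let nf : nonneg_meas f.
Proof. exact/nonneg_meas_EFin/weight_exp_tail. Qed.

Let nH : nonneg_meas H.
Proof. exact/nonneg_meas_EFin/weight_step. Qed.

Let wwT : weight wT. Proof. exact: weight_mix. Qed.

Let weight_trans (h : R -> R) s : weight h -> weight (fun x => h (s + (x - b))).
Proof.
move=> [mh h0]; split=> //; apply: measurableT_comp => //.
by apply: measurable_funD => //; apply: measurable_funD.
Qed.

Let weight_scale (h : R -> R) s : weight h -> weight (fun x => h (s * x)).
Proof.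
by move=> [mh h0]; split=> //; apply: measurableT_comp => //; apply: measurable_funM.
Qed.

Let weight_logistic : weight (@logistic R).
Proof.
have e0 := @expR_gt0 R.
split; last exact: logistic_ge0.
rewrite (_ : @logistic R = fun s => expR s * expR (- ln (1 + expR s))).
  apply: measurable_funM => //; apply: measurableT_comp => //.
  apply: measurableT_comp => //; apply: measurableT_comp => //.
  exact: measurable_funD.
by apply/funext => s; rewrite expRN lnK// posrE addr_gt0.
Qed.

Let weight_logistic' : weight (@logistic' R).
Proof.
have e0 := @expR_gt0 R.
split; last exact: logistic'_ge0.
rewrite (_ : @logistic' R = fun s => expR s * expR (- ln (1 + expR s)) ^+ 2).
  apply: measurable_funM => //; apply: measurable_funX.
  apply: measurableT_comp => //; apply: measurableT_comp => //.
  apply: measurableT_comp => //; exact: measurable_funD.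
by apply/funext => s; rewrite expRN lnK ?posrE ?addr_gt0// exprVn.
Qed.

Let wconv_num w g (c : R) s : weight w -> wexp F w (cst 1) = 1%E ->
  nonneg_meas g -> (forall t, g t <= c%:E)%E ->
  exists2 x : R, 0 <= x <= c & wconv F b w g s = x%:E.
Proof.
move=> ww w1 ng gc; have le := wconv_le_cst b s ww w1 ng gc.
have [_ /(_ s)] := nonneg_meas_wconv F b ww ng.
move: le; case: (wconv _ _ _ _ _) => [x| |]//=.
by rewrite !lee_fin => xc x0; exists x => //; rewrite x0.
Qed.

(** Positivity and linearity of [A^i B^k], transported to real numbers; the common bound [c1] makes
    all values finite. Extra terms stand on both sides, so that with one coefficient 0 the statement
    serves both telescoping arguments. *)
Let fine_wconv2_le h1 h2 g1 g2 (c c' c1 : R) i k s : 0 <= c -> 0 <= c' ->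
  nonneg_meas h1 -> nonneg_meas h2 -> nonneg_meas g1 -> nonneg_meas g2 ->
  (forall t, h1 t <= c1%:E)%E -> (forall t, h2 t <= c1%:E)%E ->
  (forall t, g1 t <= c1%:E)%E -> (forall t, g2 t <= c1%:E)%E ->
  (forall t, h1 t + c%:E * g1 t <= h2 t + c'%:E * g2 t)%E ->
  fine (AB i k h1 s) + c * fine (AB i k g1 s) <=
  fine (AB i k h2 s) + c' * fine (AB i k g2 s).
Proof.
move=> c0 c'0 nh1 nh2 ng1 ng2 h1c h2c g1c g2c le.
have cg1 := nonneg_measZ c0 ng1; have cg2 := nonneg_measZ c'0 ng2.
have := le_wconv2 F b wwA wwB i k s (nonneg_measD nh1 cg1) (nonneg_measD nh2 cg2) le.
rewrite !(wconv2D F b wwA wwB)// !(wconv2Z F b wwA wwB)//.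
have fin g : nonneg_meas g -> (forall t, g t <= c1%:E)%E ->
    AB i k g s = (fine (AB i k g s))%:E.
  move=> ng gc; rewrite fineK//.
  exact: (wconv2_fin_num b wwA wwB wA1 wB1 i k s ng gc).
by rewrite (fin h1)// (fin h2)// (fin g1)// (fin g2)// -!EFinM -!EFinD lee_fin.
Qed.

Let f1 t : (f t <= 1%:E)%E.
Proof. by rewrite lee_fin exp_tail_le1// ltW. Qed.

Let H1 t : (H t <= 1%:E)%E.
Proof. by rewrite lee_fin; case/andP: (step_01 t). Qed.

(** The exponential tail lies below 4 times the slope of a rescaled logistic function. Each exchange
    of an [A] for a [B] raises the logistic average by at least [c] times the averaged slope, and
    the total rise is at most 1. Nothing depends on the starting point. *)
Lemma iter_mix_le : exists2 C : R, 0 < C &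
  forall m (W : R), (forall k, binw p q m k <= W) ->
  forall a, fine (iter m T f a) <= C * W.
Proof.
(* [eta] is small enough for the drift to beat the quadratic term in both moment bounds, and at most
   [th], so that [exp(-th s) <= exp(-eta s)] for [s > 0]. *)
pose eta := Num.min (Num.min l0 th) (Num.min (q * D / (2 * C2)) (p * D / (2 * C2))).
have [eta0 eta_l0 eta_th etaq etap] : [/\ 0 < eta, eta <= l0, eta <= th,
    eta <= q * D / (2 * C2) & eta <= p * D / (2 * C2)].
  split; last 4 first.
  - by rewrite /eta !ge_min lexx.
  - by rewrite /eta !ge_min lexx orbT.
  - by rewrite /eta !ge_min lexx !orbT.
  - by rewrite /eta !ge_min lexx !orbT.
  by rewrite !lt_min l00 th0 !divr_gt0// !mulr_gt0.
have small x : 0 < x -> eta <= x * D / (2 * C2) -> - (eta * x * D) + C2 * eta ^+ 2 < 0.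
  move=> x0; rewrite ler_pdivlMr ?mulr_gt0// => h.
  have : 0 < eta * (x * D) by rewrite !mulr_gt0.
  have : eta * (eta * (2 * C2)) <= eta * (x * D) by rewrite ler_pM2l.
  by rewrite expr2; lra.
pose alpha := expR (- (eta * q * D) + C2 * eta ^+ 2).
pose beta := expR (- (eta * p * D) + C2 * eta ^+ 2).
have alpha1 : alpha < 1 by rewrite -expR0 ltr_expR small.
have beta1 : beta < 1 by rewrite -expR0 ltr_expR small.
(* The sum of the gains [1 - alpha] from [A] and [1 - beta] from [B]. *)
pose c := 2 - alpha - beta.
have c0 : 0 < c by rewrite /c; lra.
pose Phi := fun s : R => logistic (eta * s).
pose G := fun s : R => logistic' (eta * s).
have wPhi : weight Phi by exact: weight_scale.
have wG : weight G by exact: weight_scale.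
have Phi1 (t : R) : ((EFin \o Phi) t <= 1%:E)%E by rewrite lee_fin logistic_le1.
have G1 (t : R) : ((EFin \o G) t <= 1%:E)%E by rewrite lee_fin logistic'_le1.
have nPhi := nonneg_meas_EFin wPhi; have nG := nonneg_meas_EFin wG.
(* The upper bound of [logistic_diff] integrated against [A]: a step of [A] lowers [Phi] by at least
   [(1 - alpha) G]. *)
have hA (s : R) : (wexp F wA (fun x => Phi (s + (x - b))%R) + (G s)%:E <=
    (Phi s)%:E + (G s * alpha)%R%:E)%E.
  have [_ /(_ s) Gs] := wG; have [_ /(_ s) Ps] := wPhi.
  have we := weight_expR eta b.
  apply: (@le_trans _ _ (wexp F wA (fun x => Phi s + G s * expR (eta * (x - b))))).
    rewrite -[X in (_ + X <= _)%E](wexp_cst Gs wwA wA1) -wexpD//; last exact: weight_trans.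
    apply: le_wexp => //.
    - split; last by move=> x; rewrite addr_ge0//; case: wPhi.
      by apply: measurable_funD => //; case: (weight_trans s wPhi).
    - split; last by move=> x; rewrite addr_ge0// mulr_ge0// expR_ge0.
      by apply: measurable_funD => //; apply: measurable_funM => //; case: we.
    move=> x _; rewrite /Phi /cst mulrDr.
    have [z /andP[_ z2] ->] := logistic_diff (eta * s) (eta * (x - b)).
    by have := ler_wpM2l Gs z2; rewrite -/(G s) mulrBr mulr1; lra.
  rewrite wexpD//; last first.
    split; last by move=> x; rewrite mulr_ge0// expR_ge0.
    by apply: measurable_funM => //; case: we.
  rewrite (wexp_cst Ps wwA wA1) wexpZ// (EFinM (G s)) leeD2l// lee_wpmul2l//.
  by apply: mgfA; rewrite ger0_norm// ltW.
(* The lower bound of [logistic_diff] integrated against [B]: a step of [B] raises [Phi] by at least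
   [(1 - beta) G]. *)
have hB (s : R) : ((Phi s)%:E + (G s)%:E <=
    wexp F wB (fun x => Phi (s + (x - b))%R) + (G s * beta)%R%:E)%E.
  have [_ /(_ s) Gs] := wG; have [_ /(_ s) Ps] := wPhi.
  have we := weight_expR (- eta) b.
  have PG : 0 <= Phi s + G s by rewrite addr_ge0.
  have wGe : weight (fun x => G s * expR (- eta * (x - b))).
    split; last by move=> x; rewrite mulr_ge0// expR_ge0.
    by apply: measurable_funM => //; case: we.
  have wPs : weight (fun x => Phi (s + (x - b))) by exact: weight_trans.
  apply: (@le_trans _ _ (wexp F wB (fun x =>
     Phi (s + (x - b)) + G s * expR (- eta * (x - b))))).
    rewrite -EFinD -(wexp_cst PG wwB wB1); apply: le_wexp => //.
    - split; last by move=> x; rewrite addr_ge0//; [case: wPs|case: wGe].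
      by apply: measurable_funD => //; [case: wPs|case: wGe].
    move=> x _; rewrite /Phi /cst mulrDr.
    have [z /andP[z1 _] ->] := logistic_diff (eta * s) (eta * (x - b)).
    by have := ler_wpM2l Gs z1; rewrite -/(G s) mulrBr mulr1 mulNr; lra.
  rewrite wexpD// wexpZ// (EFinM (G s)) leeD2l// lee_wpmul2l//.
  have := @mgfB (- eta); rewrite normrN gtr0_norm// => /(_ eta_l0).
  by rewrite sqrrN !mulNr.
have AB_le (s : R) : (A (EFin \o Phi) s + c%:E * (EFin \o G) s <= B (EFin \o Phi) s)%E.
  move: (hA s) (hB s); rewrite -!wconv_EFin /=.
  have [x _ ->] := wconv_num s wwA wA1 nPhi Phi1.
  have [y _ ->] := wconv_num s wwB wB1 nPhi Phi1.
  rewrite -(EFinM c) -!EFinD !lee_fin => h1 h2.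
  rewrite /c mulrBl mulrBl; lra.
(* Among m + 1 factors, [u k] has k equal to [B]; passing to [u k.+1] replaces a single [A] by a
   [B]. *)
have tele m (a : R) : c * \sum_(k < m.+1) fine (AB (m - k) k (EFin \o G) a) <= 1.
  pose u k := fine (AB (m.+1 - k) k (EFin \o Phi) a).
  have step k : (k <= m)%N -> c * fine (AB (m - k) k (EFin \o G) a) <= u k.+1 - u k.
    move=> km; rewrite /u subSS subSn// lerBrDl.
    have nA := nonneg_meas_wconv F b wwA nPhi.
    have nB := nonneg_meas_wconv F b wwB nPhi.
    rewrite -(wconv2A F b wwA wwB)// -(wconv2B F b wA wB).
    rewrite [leRHS](_ : _ = fine (AB (m - k) k (B (EFin \o Phi)) a) +
      0 * fine (AB (m - k) k (EFin \o G) a)); last by rewrite mul0r addr0.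
    apply: (@fine_wconv2_le _ _ _ _ _ _ 1) => //; first exact: ltW.
    - by move=> t; exact: wconv_le_cst.
    - by move=> t; exact: wconv_le_cst.
    - by move=> t; rewrite mul0e adde0; exact: AB_le.
  rewrite mulr_sumr.
  apply: (@le_trans _ _ (\sum_(k < m.+1) (u k.+1 - u k))).
    by apply: ler_sum => k _; apply: step; rewrite -ltnS.
  rewrite -(big_mkord xpredT (fun k => u k.+1 - u k)) telescope_sumr//.
  rewrite lerBlDr /u subnn -[leLHS]addr0 lerD ?wconv2_ge0//.
  rewrite -lee_fin fineK; first exact: wconv2_le_cst.
  exact: (wconv2_fin_num b wwA wwB wA1 wB1 _ _ _ nPhi Phi1).
have fG s : ((EFin \o exp_tail th) s <= 4%:E * (EFin \o G) s)%E.
  rewrite -EFinM lee_fin /exp_tail; have [/step_npos->|s0] := leP s 0.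
    by rewrite mulr0 mulr_ge0// logistic'_ge0.
  rewrite step_pos// mulr1.
  apply: le_trans (logistic'_ge (mulr_ge0 (ltW eta0) (ltW s0))).
  by rewrite ler_expR lerN2 ler_pM2r.
exists (4 / c) => [|m W binW a]; first by rewrite divr_gt0.
rewrite (iter_mix_binw b p0 q0 pq1 wwA wwB wA1 wB1 _ _ nf f1).
have W0 : 0 <= W by apply: le_trans (binW 0%N); rewrite binw_ge0.
apply: (@le_trans _ _ (\sum_(k < m.+1) W * (4 * fine (AB (m - k) k (EFin \o G) a)))).
  apply: ler_sum => k _; apply: ler_pM; rewrite ?binw_ge0 ?wconv2_ge0//.
  have le4 : (0 <= 4 :> R)%R by [].
  have := le_wconv2 F b wwA wwB (m - k) k a nf (nonneg_measZ le4 nG) fG.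
  rewrite (wconv2Z F b wwA wwB)// -lee_fin EFinM.
  rewrite !fineK//; first exact: (wconv2_fin_num b wwA wwB wA1 wB1 _ _ _ nG G1).
  exact: (wconv2_fin_num b wwA wwB wA1 wB1 _ _ _ nf f1).
rewrite -mulr_sumr -mulr_sumr mulrC ler_wpM2r//.
by rewrite ler_wpM2l// -[leRHS]mulr1 ler_pdivlMl.
Qed.

Let CA0 : 0 <= CA.
Proof.
by rewrite -lee_fin (le_trans _ wACA)// wexp_ge0//; exact: weight_expR.
Qed.

(** [1 / q] accounts for the share of [B] in the mixture, [exp(th K)] for the longest step of [B],
    and the two terms of [1 + CA] for the two signs of the starting point in [wconv_step_le]. *)
Let C1 := expR (th * K) * (1 + CA) / q.

Let C10 : 0 < C1.
Proof. by rewrite divr_gt0// mulr_gt0 ?expR_gt0// ltr_pwDl. Qed.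

(** For [s <= 0], a step of [B] that passes 0 ends at most at [K], where [f >= exp(-th K)]. For
    [s > 0], [B H <= 1], and [1 - A H] is at most [CA exp(-th s)] by Markov's inequality, while
    [B f >= exp(-th (s + K))]. *)
Let wconv_step_le s : (B H s <= A H s + C1%:E * T f s)%E.
Proof.
have nA := nonneg_meas_wconv F b wwA nf.
rewrite (wconvDl F b s (ltW p0) (ltW q0) wwA wwB nf).
have [z /andP[z0 _] zE] := wconv_num s wwA wA1 nf f1.
have [y /andP[y0 _] yE] := wconv_num s wwB wB1 nf f1.
have [u /andP[u0 _] uE] := wconv_num s wwA wA1 nH H1.
have [v /andP[_ v1] vE] := wconv_num s wwB wB1 nH H1.
rewrite zE yE uE vE -(EFinM p) -(EFinM q) -(EFinD (p * z)) -(EFinM C1) -(EFinD u).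
rewrite lee_fin.
have eK0 := expR_gt0 (th * K).
have [s0|s0] := leP s 0.
- have vy : v <= expR (th * K) * y.
    rewrite -lee_fin EFinM -vE -yE !wconv_EFin -wexpZ ?expR_ge0//; last first.
      exact/weight_trans/weight_exp_tail.
    apply: le_wexp => //; first exact/weight_trans/weight_step.
      have [mt t0] := weight_trans s (weight_exp_tail th).
      by split; [exact: measurable_funM|move=> x; rewrite mulr_ge0 ?expR_ge0].
    move=> x /wBK /andP[bx xK]; rewrite /exp_tail.
    have [/step_npos->|sx] := leP (s + (x - b)) 0; first by rewrite !mulr0.
    rewrite step_pos// mulr1 -expRD -expR0 ler_expR -mulrBr mulr_ge0 ?(ltW th0)//.
    by lra.
  apply: le_trans vy _; apply: (@le_trans _ _ (C1 * (q * y))); last first.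
    by rewrite -[leLHS]add0r lerD// ler_wpM2l ?(ltW C10)// lerDr mulr_ge0// ltW.
  rewrite /C1 (_ : _ / q * (q * y) = expR (th * K) * ((1 + CA) * y)); last first.
    by field; rewrite gt_eqF.
  by rewrite ler_wpM2l ?(ltW eK0)// ler_peMl// lerDl.
- have es0 : 0 <= expR (- th * s) by exact: expR_ge0.
  have hu : 1 <= u + expR (- th * s) * CA.
    rewrite -lee_fin EFinD EFinM.
    apply: (@le_trans _ _ (u%:E + (expR (- th * s))%:E *
        wexp F wA (fun x => expR (- th * (x - b))))%E); last first.
      by rewrite leeD2l// lee_wpmul2l// lee_fin.
    rewrite -uE wconv_EFin -wexpZ//; last exact: weight_expR.
    have [mt t0] := weight_trans s (@weight_step R).
    have [me e0] := weight_expR (- th) b.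
    rewrite -wexpD//; last first.
      by split; [exact: measurable_funM|move=> x; rewrite mulr_ge0].
    rewrite -wA1; apply: le_wexp => //.
      split; last by move=> x; rewrite addr_ge0// mulr_ge0.
      by apply: measurable_funD => //; exact: measurable_funM.
    move=> x _; rewrite /cst; have [sx|sx] := leP (s + (x - b)) 0.
      rewrite step_npos// add0r -expRD -mulrDr mulNr -expR0 ler_expR oppr_ge0.
      by rewrite pmulr_rle0.
    by rewrite step_pos// lerDl mulr_ge0 ?expR_ge0.
  have hy : expR (- th * s) <= expR (th * K) * y.
    rewrite -ler_pdivrMl// -expRN -expRD -lee_fin -yE wconv_EFin.
    rewrite -(wexp_cst (expR_ge0 _) wwB wB1); apply: le_wexp => //.
    - exact: weight_cst (expR_ge0 _).
    - exact/weight_trans/weight_exp_tail.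
    move=> x /wBK /andP[bx xK]; rewrite /cst /exp_tail step_pos; last by lra.
    rewrite mulr1 ler_expR mulNr -opprD lerN2 -mulrDr ler_pM2l//.
    by lra.
  have : CA * expR (- th * s) <= CA * (expR (th * K) * y) by rewrite ler_wpM2l.
  have pz : 0 <= p * z by rewrite mulr_ge0// ltW.
  have : C1 * (q * y) <= C1 * (p * z + q * y).
    by rewrite ler_wpM2l ?(ltW C10)// lerDr.
  rewrite {1}/C1 (_ : _ / q * (q * y) = expR (th * K) * ((1 + CA) * y)); last first.
    by field; rewrite gt_eqF.
  have : 0 <= expR (th * K) * y by rewrite mulr_ge0 ?expR_ge0.
  by lra.
Qed.

Let expR_N2 : expR (- 2) <= 4^-1 :> R.
Proof.
rewrite expRN lef_pV2 ?posrE ?expR_gt0//.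
have h := @expR_ge1Dx R 1.
rewrite (_ : 2 = 1 + 1 :> R)// expRD.
by apply: le_trans (ler_pM _ _ h h) => //; rewrite ?addr_ge0//; lra.
Qed.

(* exp (l s) and exp (- l s) with l = 1 / sqrt n dominate step and 1 - step. *)
Lemma iter_mix_ge : exists c1, exists2 c2 : R, 0 < c1 /\ 1 <= c2 & exists N : nat,
  forall m, (N <= m)%N -> forall w, 0 <= w ->
  (forall k, `|k%:R - q * m.+1%:R| <= c2 * Num.sqrt m.+1%:R -> w <= binw p q m k) ->
  c1 * w <= fine (iter m.+1 T f 0).
Proof.
(* With [l = 1 / r], the Chernoff exponent at distance [c r] from the centre is [C2 - D c = -2], and
   [exp(-2) <= 1/4]. *)
pose c := (C2 + 2) / D.
have c0 : 0 < c by rewrite divr_gt0// addr_gt0.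
exists (2 * C1)^-1; exists (c + 1); first by rewrite invr_gt0 mulr_gt0// lerDr ltW.
(* Ensures that [1 / r <= l0] and that the window of half-width [(c + 1) r] about [q r^2] lies
   between 0 and m + 1. *)
pose r0 := l0^-1 + (c + 1) / p + (c + 1) / q.
have cp0 : 0 < (c + 1) / p by rewrite divr_gt0// addr_gt0.
have cq0 : 0 < (c + 1) / q by rewrite divr_gt0// addr_gt0.
have li0 : 0 < l0^-1 by rewrite invr_gt0.
have r00 : 0 < r0 by rewrite /r0 !addr_gt0.
exists (Num.truncn (r0 ^+ 2)) => m Nm w w0 hw.
set r := Num.sqrt _ in hw.
have rE : r ^+ 2 = m.+1%:R by rewrite sqr_sqrtr.
have r1 : r0 <= r.
  rewrite -(@ler_sqr _ r0 r) ?nnegrE ?(ltW r00) ?sqrtr_ge0//.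
  rewrite rE; apply: ltW; apply: (lt_le_trans (truncnS_gt (r0 ^+ 2))).
  by rewrite ler_nat ltnS.
have rp : 0 < r by rewrite (lt_le_trans _ r1).
have hl : r^-1 <= l0.
  by rewrite -[leRHS]invrK lef_pV2 ?posrE//; apply: le_trans r1; rewrite /r0; lra.
have hp : (c + 1) <= p * r.
  by rewrite [leRHS]mulrC -ler_pdivrMr//; apply: le_trans r1; rewrite /r0; lra.
have hq : (c + 1) <= q * r.
  by rewrite [leRHS]mulrC -ler_pdivrMr//; apply: le_trans r1; rewrite /r0; lra.
have hr1 : 1 <= r.
  by have : p * r <= r; [rewrite ger_pMl// -pq1 lerDl ltW|lra].
have hp2 : (c + 1) * r <= p * r ^+ 2 by rewrite expr2 mulrA ler_pM2r.
have hq2 : (c + 1) * r <= q * r ^+ 2 by rewrite expr2 mulrA ler_pM2r.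
have cr0 : 0 <= c * r by rewrite mulr_ge0// ltW.
(* Rounding outwards enlarges the half-width [c r] by at most 1, which [c + 1] absorbs because
   [r >= 1]. *)
pose k1 := Num.truncn (q * r ^+ 2 - c * r).
pose k2 := (Num.truncn (q * r ^+ 2 + c * r)).+1.
have /andP[k11 k12] : k1%:R <= q * r ^+ 2 - c * r < k1.+1%:R.
  by apply: truncn_itv; lra.
have /andP[k21 k22] : (k2.-1)%:R <= q * r ^+ 2 + c * r < k2%:R.
  by apply: truncn_itv; lra.
have k2E : k2%:R = k2.-1%:R + 1 :> R by rewrite -natr1.
have prq : p * r ^+ 2 + q * r ^+ 2 = r ^+ 2 by rewrite -mulrDl pq1 mul1r.
have k2m : (k2 <= m.+1)%N.
  by rewrite -(ler_nat R) -rE k2E; lra.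
have k12' : (k1 < k2)%N by rewrite -(ltr_nat R); lra.
pose a k := fine (AB (m.+1 - k) k H 0).
(* Since the two means are [- q D] and [p D], only the excess of [k] over [q r^2] leaves a linear
   term. *)
have expo k l : (k <= m.+1)%N ->
    (m.+1 - k)%:R * (- (l * q * D) + C2 * l ^+ 2) + k%:R * (l * p * D + C2 * l ^+ 2)
      + l * 0 = l * D * (k%:R - q * r ^+ 2) + C2 * (l * r) ^+ 2 :> R.
  move=> km; rewrite natrB// -rE (_ : p = 1 - q); last by rewrite -pq1 addrK.
  by ring.
have lr : r^-1 * r = 1 by rewrite mulVf// gt_eqF.
have lN : `|- r^-1| <= l0 by rewrite normrN ger0_norm// invr_ge0 ltW.
have lP : `|r^-1| <= l0 by rewrite ger0_norm// invr_ge0 ltW.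
have nE l : nonneg_meas (fun t => (expR (l * t))%:E : \bar R).
  split; last by move=> t; rewrite lee_fin expR_ge0.
  by apply/measurable_EFinP; apply: measurableT_comp => //; exact: measurable_funM.
have DcC : D * c = C2 + 2 by rewrite /c mulrC divfK// gt_eqF.
have aE k : AB (m.+1 - k) k H 0 = (a k)%:E.
  by rewrite fineK//; exact: (wconv2_fin_num b wwA wwB wA1 wB1 _ _ _ nH H1).
have ak1 : a k1 <= 4^-1.
  rewrite -lee_fin -aE.
  apply: (@le_trans _ _ (AB (m.+1 - k1) k1 (fun t => (expR (r^-1 * t))%:E) 0)).
    apply: le_wconv2 => // t; rewrite lee_fin.
    have [/step_npos->|t0] := leP t 0; first exact: expR_ge0.
    by rewrite step_pos// -expR0 ler_expR mulr_ge0 ?invr_ge0 ?(ltW rp) ?(ltW t0).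
  apply: le_trans (wconv2_expR wwA wwB _ _ _ (mgfA lP) (mgfB lP)) _.
  rewrite expo ?(leq_trans (ltnW k12'))// lr expr1n mulr1 lee_fin.
  apply: le_trans expR_N2; rewrite ler_expR.
  have : r^-1 * D * (k1%:R - q * r ^+ 2) <= r^-1 * D * (- (c * r)).
    by rewrite ler_pM2l ?mulr_gt0 ?invr_gt0//; lra.
  rewrite (_ : r^-1 * D * (- (c * r)) = - (D * c)); last by field; rewrite gt_eqF.
  by rewrite DcC; lra.
have ak2 : 1 <= a k2 + 4^-1.
  rewrite -lee_fin EFinD -aE -[leLHS](wconv2_cst1 b wwA wwB wA1 wB1 (m.+1 - k2) k2 0).
  apply: (@le_trans _ _ (AB (m.+1 - k2) k2 (H \+ (fun t => (expR (- r^-1 * t))%:E))%E 0)).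
    apply: le_wconv2 => //.
    - exact: nonneg_measD.
    move=> t; rewrite -[leRHS]/(step t + expR (- r^-1 * t))%:E lee_fin.
    have [t0|t0] := leP t 0.
      by rewrite step_npos// add0r -expR0 ler_expR mulNr -mulrN mulr_ge0 ?oppr_ge0 ?invr_ge0 ?(ltW rp).
    by rewrite step_pos// lerDl expR_ge0.
  rewrite wconv2D// leeD2l//.
  apply: le_trans (wconv2_expR wwA wwB _ _ _ (mgfA lN) (mgfB lN)) _.
  rewrite expo// !mulNr lr sqrrN expr1n mulr1 lee_fin.
  apply: le_trans expR_N2; rewrite ler_expR.
  have : r^-1 * D * (c * r) <= r^-1 * D * (k2%:R - q * r ^+ 2).
    by rewrite ler_pM2l ?mulr_gt0 ?invr_gt0//; lra.
  rewrite (_ : r^-1 * D * (c * r) = D * c); last by field; rewrite gt_eqF.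
  by rewrite DcC; lra.
have nT := nonneg_meas_wconv F b wwT nf.
have wT1 := wexp_mix1 p0 q0 pq1 wwA wwB wA1 wB1.
have T1 t : (T f t <= 1%:E)%E by exact: wconv_le_cst.
pose g k := fine (AB (m - k) k (T f) 0).
have ag k : (k <= m)%N -> a k.+1 - a k <= C1 * g k.
  move=> km; rewrite /a subSS subSn// lerBlDl.
  rewrite -(wconv2A F b wwA wwB)// -(wconv2B F b wA wB).
  rewrite [leLHS](_ : _ = fine (AB (m - k) k (B H) 0) +
    0 * fine (AB (m - k) k (T f) 0)); last by rewrite mul0r addr0.
  apply: (@fine_wconv2_le _ _ _ _ _ _ 1) => //; first exact: ltW.
  - exact: nonneg_meas_wconv.
  - exact: nonneg_meas_wconv.
  - by move=> t; exact: wconv_le_cst.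
  - by move=> t; exact: wconv_le_cst.
  - by move=> t; rewrite mul0e adde0; exact: wconv_step_le.
(* [a] climbs from at most 1/4 to at least 3/4 across the window. *)
have tele : 2^-1 <= C1 * \sum_(k1 <= k < k2) g k.
  apply: (@le_trans _ _ (a k2 - a k1)); first by lra.
  rewrite -telescope_sumr ?(ltnW k12')// mulr_sumr.
  rewrite big_nat_cond [leRHS]big_nat_cond; apply: ler_sum => k /andP[/andP[_ kk2] _].
  by apply: ag; rewrite -ltnS (leq_trans kk2).
(* One factor [T] stays with [f], because [wconv_step_le] bounds the increments by [T f]; this is
   why m + 1 steps appear. *)
rewrite iterSr (iter_mix_binw b p0 q0 pq1 wwA wwB wA1 wB1 _ _ nT T1).
apply: (@le_trans _ _ (w * \sum_(k1 <= k < k2) g k)).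
  rewrite mulrC ler_wpM2l// invfM mulrC ler_pdivrMl//.
rewrite -(big_mkord xpredT (fun k => binw p q m k * g k)).
rewrite (big_cat_nat (leq0n k2) k2m)/= (big_cat_nat (leq0n k1) (ltnW k12'))/=.
have S0 i j : 0 <= \sum_(i <= k < j) binw p q m k * g k.
  by apply: sumr_ge0 => k _; rewrite mulr_ge0 ?binw_ge0// wconv2_ge0.
apply: (@le_trans _ _ (\sum_(k1 <= k < k2) binw p q m k * g k)); last first.
  by rewrite -[leLHS]addr0 lerD// -[leLHS]add0r lerD.
rewrite mulr_sumr big_nat_cond [leRHS]big_nat_cond.
apply: ler_sum => k /andP[/andP[kk1 kk2] _].
rewrite ler_wpM2r ?wconv2_ge0//; apply: hw; rewrite -rE ler_norml.
have h1 : k1%:R <= k%:R :> R by rewrite ler_nat.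
have h2 : k%:R <= k2.-1%:R :> R by rewrite ler_nat.
by move: k12; rewrite -natr1 => k12; apply/andP; split; lra.
Qed.

(** The weight M at the integer part of [q (m + 1)] serves both sides: all weights are at most
    [C' M], and those in the window are at least [M / C']. *)
Lemma iter_mix_comparison : exists2 C : R, 0 < C & exists N : nat,
  forall m, (N <= m)%N -> forall a, fine (iter m T f a) <= C * fine (iter m.+1 T f 0).
Proof.
have [C0 C00 hle] := iter_mix_le.
have [c1 [c2 [c10 c21] [N1 hge]]] := iter_mix_ge.
have c20 : 0 < c2 by rewrite (lt_le_trans _ c21).
have [C' C'0 [N2 win]] := binw_window p0 q0 pq1 c20.
exists (C0 * C' ^+ 2 / c1); first by rewrite divr_gt0// mulr_gt0// exprn_gt0.
exists (maxn N1 N2) => m; rewrite geq_max => /andP[m1 m2] a.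
pose k0 := Num.truncn (q * m.+1%:R).
have /andP[k01 k02] : k0%:R <= q * m.+1%:R < k0.+1%:R.
  by apply: truncn_itv; rewrite mulr_ge0// ltW.
have r1 : 1 <= Num.sqrt m.+1%:R :> R by rewrite -[leLHS]sqrtr1 ler_sqrt// ler1n.
have k0w : `|k0%:R - q * m.+1%:R| <= c2 * Num.sqrt m.+1%:R.
  have : 1 <= c2 * Num.sqrt m.+1%:R by apply: le_trans (ler_pM _ _ c21 r1); rewrite ?mulr1.
  by move: k02; rewrite -natr1 ler_norml => ? ?; apply/andP; split; lra.
have b0 := binw_ge0 p0 q0 m k0.
have := hge m m1 (binw p q m k0 / C').
rewrite divr_ge0 ?(ltW C'0)// => /(_ isT) H1'.
have {}H1' : c1 * (binw p q m k0 / C') <= fine (iter m.+1 T f 0).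
  by apply: H1' => k kw; rewrite ler_pdivrMr// mulrC; exact: win.
apply: le_trans (hle m (C' * binw p q m k0) _ a) _.
  by move=> k; exact: win.
rewrite [leLHS](_ : _ = C0 * C' ^+ 2 / c1 * (c1 * (binw p q m k0 / C'))).
  by rewrite ler_wpM2l// divr_ge0 ?(ltW c10)// mulr_ge0 ?exprn_ge0// ltW.
by field; rewrite !gt_eqF.
Qed.

End local_comparison.

(** * Exponential moments and the derivative of the cumulant function *)

Section exponential_moments.
Set Implicit Arguments.
Unset Strict Implicit.
Context {R : realType} (F : probability R R) (b : R).

Lemma expR_norm_le (a y : R) : expR (a * `|y|) <= expR (a * y) + expR (- a * y).
Proof.
have [y0|y0] := leP 0 y; first by rewrite ger0_norm// lerDl expR_ge0.
by rewrite ltr0_norm// mulrN -mulNr lerDr expR_ge0.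
Qed.

(** From [exp x - 1 <= x exp x = x + x (exp x - 1)], the last product being at most [x^2 exp|x|]. *)
Lemma expR_le_quad (x : R) : expR x <= 1 + x + x ^+ 2 * expR `|x|.
Proof.
have h1 : expR x - 1 <= x * expR x.
  have := expR_ge1Dx (- x); rewrite expRN => h.
  have e0 := expR_gt0 x.
  have : (1 - x) * expR x <= 1 by rewrite -ler_pdivlMr// div1r.
  by rewrite mulrBl mul1r; lra.
have [x0|x0] := leP 0 x.
  rewrite ger0_norm// expr2 -mulrA.
  have : x * (expR x - 1) <= x * (x * expR x) by rewrite ler_wpM2l.
  by rewrite mulrBr mulr1; lra.
have h2 := expR_ge1Dx x.
have h3 : x * (expR x - 1) <= x ^+ 2.
  have : 0 <= - x * (expR x - 1 - x) by rewrite mulr_ge0//; lra.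
  by rewrite expr2; lra.
have h4 : x ^+ 2 <= x ^+ 2 * expR `|x|.
  by rewrite ler_peMr ?sqr_ge0// -expR0 ler_expR.
by move: h3; rewrite mulrBr mulr1; lra.
Qed.

Lemma sqr_le_expR (u : R) : 0 <= u -> u ^+ 2 <= 4 * expR u.
Proof.
move=> u0; have h := expR_ge1Dx (u / 2).
have : (u / 2) ^+ 2 <= expR (u / 2) ^+ 2.
  by rewrite ler_sqr ?nnegrE ?expR_ge0//; lra.
rewrite -expRM_natl (_ : 2%:R * (u / 2) = u); last by field.
by rewrite expr_div_n; lra.
Qed.

Definition itg (h : R -> R) : Prop := F.-integrable setT (EFin \o h).

(** Domination by a pair of exponentials, applied with rates on either side of a centre so as to
    control both tails. *)
Lemma itg_exp_dom (t1 t2 c : R) (h : R -> R) :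
  itg (fun x => expR (t1 * (x - b))) -> itg (fun x => expR (t2 * (x - b))) ->
  measurable_fun setT h ->
  (forall x, `|h x| <= c * (expR (t1 * (x - b)) + expR (t2 * (x - b)))) -> itg h.
Proof.
move=> i1 i2 mh hle.
have ig : F.-integrable setT
    (fun x => c%:E * ((expR (t1 * (x - b)))%:E + (expR (t2 * (x - b)))%:E))%E.
  by apply: integrableZl => //; apply: integrableD.
apply: le_integrable ig => //; first exact/measurable_EFinP.
move=> x _ /=; rewrite lee_fin; apply: le_trans (hle x) _.
by rewrite ler_norm.
Qed.

Lemma measurable_shift : measurable_fun setT (fun x : R => x - b).
Proof. exact: measurable_funD. Qed.

Lemma measurable_expRM (t : R) :
  measurable_fun setT (fun x : R => expR (t * (x - b))).
Proof. by case: (weight_expR t b). Qed.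

Lemma itgD (h1 h2 : R -> R) : itg h1 -> itg h2 -> itg (fun x => h1 x + h2 x).
Proof. by move=> i1 i2; apply: (integrableD _ i1 i2). Qed.

Lemma itgB (h1 h2 : R -> R) : itg h1 -> itg h2 -> itg (fun x => h1 x - h2 x).
Proof. by move=> i1 i2; apply: (integrableB _ i1 i2). Qed.

Lemma itgZ (c : R) (h : R -> R) : itg h -> itg (fun x => c * h x).
Proof. by move=> i; apply: (integrableZl _ c i). Qed.

Lemma itg_measurable (h : R -> R) : itg h -> measurable_fun setT h.
Proof. by move=> /measurable_int /measurable_EFinP. Qed.

Lemma itg_cst (c : R) : itg (cst c).
Proof. exact: finite_measure_integrable_cst. Qed.

Lemma wexp_Rintegral (w h : R -> R) : itg (fun x => w x * h x) ->
  wexp F w h = (\int[F]_x (w x * h x))%:E.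
Proof. by move=> i; rewrite /wexp /Rintegral fineK//; exact: integrable_fin_num. Qed.

(** If the integral vanished, [h] would be zero almost everywhere and [S] would lie in a null
    set. *)
Lemma Rintegral_gt0 (h : R -> R) (S : set R) : itg h -> (forall x, 0 <= h x) ->
  measurable S -> (0 < F S)%E -> (forall x, S x -> 0 < h x) ->
  0 < \int[F]_x h x.
Proof.
move=> ih h0 mS S0 hS; rewrite lt_neqAle Rintegral_ge0 ?andbT//.
apply/negP => /eqP e0.
have : (\int[F]_x `|(EFin \o h) x| = 0)%E.
  under eq_integral do rewrite gee0_abs ?lee_fin//.
  have -> : (\int[F]_x (EFin \o h) x = (\int[F]_x h x)%:E)%E.
    by rewrite /Rintegral fineK//; exact: integrable_fin_num.
  by rewrite -e0.
have mh : measurable_fun setT (EFin \o h) by exact: measurable_int ih.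
move/(ae_eq_integral_abs F measurableT mh) => [N [mN N0 sub]].
have SN : S `<=` N.
  move=> x Sx; apply: sub => /= /(_ I) [] hx0.
  by have := hS x Sx; rewrite hx0 ltxx.
have : (F S <= F N)%E by apply: le_measure => //; rewrite inE.
by rewrite N0 leNgt S0.
Qed.

Lemma Rintegral_expR_gt0 (t : R) : itg (fun x => expR (t * (x - b))) ->
  0 < \int[F]_x expR (t * (x - b)).
Proof.
move=> i; apply: (@Rintegral_gt0 _ setT) => //.
- by rewrite probability_setT lte01.
- by move=> x _; exact: expR_gt0.
Qed.

Lemma mgf_shift (t : R) : (mgf F t < +oo)%E ->
  itg (fun x => expR (t * (x - b))) /\
  \int[F]_x expR (t * (x - b)) = expR (- (t * b)) * fine (mgf F t).
Proof.
move=> mt.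
have i : itg (fun x => expR (t * x)).
  apply/integrableP; split.
    apply/measurable_EFinP; apply: measurableT_comp => //; exact: measurable_funM.
  by under eq_integral do rewrite gee0_abs ?lee_fin ?expR_ge0//.
have e : (fun x => expR (t * (x - b))) = fun x => expR (- (t * b)) * expR (t * x).
  by apply/funext => x; rewrite -expRD; congr expR; ring.
rewrite e; split; first exact: itgZ.
by rewrite RintegralZl.
Qed.

Lemma cgf_dom_nbhs (t0 : R) : interior (cgf_dom F) t0 ->
  exists2 e : R, 0 < e & forall t, `|t - t0| <= e -> (mgf F t < +oo)%E.
Proof.
move=> /nbhs_ballP[e /= e0 sub]; exists (e / 2); first by rewrite divr_gt0.
move=> t te; apply: sub; rewrite /ball/= distrC (le_lt_trans te)//.
by rewrite ltr_pdivrMr// ltr_pMr// ltr1n.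
Qed.

(** [e |y| <= exp(e |y|) <= exp(e y) + exp(- e y)], so the linear factor costs only a shift of the
    rate by [e]. *)
Lemma itg_shiftM (t0 e : R) : 0 < e ->
  itg (fun x => expR ((t0 + e) * (x - b))) ->
  itg (fun x => expR ((t0 - e) * (x - b))) ->
  itg (fun x => (x - b) * expR (t0 * (x - b))).
Proof.
move=> e0 i1 i2; apply: (itg_exp_dom (c := e^-1) i1 i2).
  by apply: measurable_funM; [exact: measurable_shift|exact: measurable_expRM].
move=> x; rewrite normrM (ger0_norm (expR_ge0 _)) ler_pdivlMl//.
rewrite !mulrDl !expRD -mulrDr mulrA [leRHS]mulrC ler_wpM2r ?expR_ge0//.
apply: le_trans (expR_norm_le e (x - b)).
by have := expR_ge1Dx (e * `|x - b|); lra.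
Qed.

Lemma is_derive0_quot (g : R -> R) (t0 e : R) : is_derive t0 1 g 0 -> 0 < e ->
  exists2 d : R, 0 < d & forall h, h != 0 -> `|h| < d ->
    `|h^-1 * (g (t0 + h) - g t0)| < e.
Proof.
move=> [dg g0] e0.
have : h^-1 *: ((g \o shift t0) (h *: 1) - g t0) @[h --> 0^'] --> 'D_1 g t0.
  exact: dg.
rewrite g0; move=> /cvgrPdist_lt /(_ e e0) [d /= d0 H]; exists d => // h h0 hd.
have := H h; rewrite /= !sub0r !normrN => /(_ hd h0).
by rewrite [h *: 1]mulr1 [h + t0]addrC.
Qed.

(** No differentiation under the integral: [exp(h y) >= 1 + h y] gives [phi] a supporting line of
    slope [D0] at [t0], and near [t0] the function [phi] equals [exp(cgf F t - t b)], whose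
    derivative at [t0] is 0. *)
Lemma tilted_mean_eq0 (t0 : R) : interior (cgf_dom F) t0 ->
  is_derive t0 1 (cgf F) b -> \int[F]_x ((x - b) * expR (t0 * (x - b))) = 0.
Proof.
move=> /cgf_dom_nbhs[e e0 dom] dcgf.
pose phi t := \int[F]_x expR (t * (x - b)).
have it t : `|t - t0| <= e -> itg (fun x => expR (t * (x - b))).
  by move=> /dom /mgf_shift[].
have it0 : itg (fun x => expR (t0 * (x - b))) by apply: it; rewrite subrr normr0 ltW.
have iM : itg (fun x => (x - b) * expR (t0 * (x - b))).
  apply: (itg_shiftM e0); apply: it.
    by rewrite addrAC subrr add0r ger0_norm// ltW.
  by rewrite addrAC subrr add0r normrN ger0_norm// ltW.
set D0 := \int[F]_x _.
pose g t := expR (cgf F t - t * b).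
have gphi t : `|t - t0| <= e -> g t = phi t.
  move=> te; have [i phiE] := mgf_shift (dom t te).
  rewrite /phi phiE /g /cgf expRD [LHS]mulrC lnK//.
  have := Rintegral_expR_gt0 i; rewrite phiE posrE.
  by rewrite pmulr_rgt0// expR_gt0.
have dg : is_derive t0 1 g 0.
  have d1 : is_derive t0 1 (fun t => cgf F t - t * b) (b - b).
    apply: is_deriveB.
    have := @is_deriveM R R id (cst b) t0 1 1 0 _ _.
    by rewrite scaler0 add0r /cst [_ *: 1]mulr1; apply.
  have := @is_derive1_comp R expR (fun t => cgf F t - t * b) t0 _ _ _ d1.
  rewrite subrr => /(_ _ (is_derive_expR _)).
  by rewrite mulr0.
have lin h : `|h| <= e -> phi t0 + h * D0 <= phi (t0 + h).
  move=> he; rewrite -RintegralZl// -RintegralD//; last exact: itgZ.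
  apply: le_Rintegral => //.
  - by apply: itgD => //; exact: itgZ.
  - by apply: it; rewrite addrAC subrr add0r.
  move=> x _; rewrite [(t0 + h) * _]mulrDl expRD.
  rewrite [leLHS](_ : _ = expR (t0 * (x - b)) * (1 + h * (x - b))); last by ring.
  by rewrite ler_wpM2l ?expR_ge0// expR_ge1Dx.
apply/eqP; apply/negPn/negP => D00.
have nD0 : 0 < `|D0| by rewrite normr_gt0.
have [d d0 Hd] := is_derive0_quot dg nD0.
pose m := Num.min (d / 2) e.
have m0 : 0 < m by rewrite lt_min e0 andbT divr_gt0.
have md : m < d by rewrite gt_min ltr_pdivrMr// ltr_pMr// ltr1n.
have me : m <= e by rewrite ge_min lexx orbT.
(* [h] takes the sign of [D0], so the supporting line rises by [|h| |D0|], which the vanishing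
   derivative forbids. *)
pose h := Num.sg D0 * m.
have hm : `|h| = m by rewrite normrM normr_sg D00 mul1r gtr0_norm.
have h0 : h != 0 by rewrite -normr_gt0 hm.
have := Hd h h0; rewrite hm => /(_ md).
have -> : g (t0 + h) = phi (t0 + h).
  by apply: gphi; rewrite [t0 + h]addrC addrK hm.
have -> : g t0 = phi t0 by apply: gphi; rewrite subrr normr0 ltW.
rewrite normrM normfV hm mulrC ltr_pdivrMr// ltNge => /negP; apply.
apply: (@le_trans _ _ (h * D0)).
  by rewrite /h mulrAC -normrEsg.
by apply: le_trans (ler_norm _); rewrite lerBrDl lin// hm.
Qed.

(** Integrating [expR_le_quad] against [v] gives 1 plus the mean times [l] plus [C l^2], at most the
    exponential of the last two terms. Domination of [v] by a tilt with room [2 l0] on both sides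
    provides the moments. *)
Lemma quadratic_mgf_bound (v : R -> R) (t0 c l0 : R) : weight v -> 0 < l0 ->
  (forall x, v x <= c * expR (t0 * (x - b))) -> \int[F]_x v x = 1 ->
  itg (fun x => expR ((t0 + 2 * l0) * (x - b))) ->
  itg (fun x => expR ((t0 - 2 * l0) * (x - b))) ->
  itg (fun x => v x * (x - b)) /\
  exists2 C : R, 0 < C & forall l, `|l| <= l0 ->
   (wexp F v (fun x => expR (l * (x - b)))
     <= (expR (l * (\int[F]_x (v x * (x - b))) + C * l ^+ 2))%R%:E)%E.
Proof.
move=> [mv v0] l00 vc v1 i1 i2.
have dom (h : R -> R) k : measurable_fun setT h -> 0 <= k ->
    (forall x, `|h x| <= k * expR (2 * l0 * `|x - b|)) -> itg (fun x => v x * h x).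
  move=> mh k0 hk; apply: (itg_exp_dom (c := c * k) i1 i2).
    exact: measurable_funM.
  move=> x; rewrite normrM (ger0_norm (v0 x)).
  apply: (@le_trans _ _ (c * expR (t0 * (x - b)) * (k * expR (2 * l0 * `|x - b|)))).
    by apply: ler_pM.
  have c0 : 0 <= c.
    by rewrite -(pmulr_lge0 _ (expR_gt0 (t0 * (x - b)))) (le_trans (v0 x)).
  rewrite [(t0 + _) * _]mulrDl [(t0 - _) * _]mulrDl !expRD -mulrDr.
  rewrite mulrACA ler_wpM2l ?mulr_ge0// ler_wpM2l ?expR_ge0//.
  exact: expR_norm_le.
have mb := measurable_shift.
have l2 : 0 < 2 * l0 by rewrite mulr_gt0.
have iv : itg v.
  rewrite (_ : v = fun x => v x * cst 1 x); last by apply/funext => x; rewrite mulr1.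
  apply: (dom _ 1) => // x; rewrite normr1 mul1r -[leLHS]expR0 ler_expR.
  by rewrite mulr_ge0// ltW.
have iy : itg (fun x => v x * (x - b)).
  apply: (dom _ (2 * l0)^-1) => //; first by rewrite invr_ge0 ltW.
  move=> x; rewrite ler_pdivlMl//.
  by have := expR_ge1Dx (2 * l0 * `|x - b|); lra.
split => //.
(* Dominates the remainder: [y^2 exp(l0 |y|) <= (4 / l0^2) exp(2 l0 |y|)]. *)
pose Q x := 4 / l0 ^+ 2 * expR (2 * l0 * `|x - b|).
have mQ : measurable_fun setT Q.
  apply: measurable_funM => //; apply: measurableT_comp => //.
  apply: measurable_funM => //; exact: measurableT_comp.
have k0 : 0 <= 4 / l0 ^+ 2 by rewrite divr_ge0// exprn_ge0// ltW.
have iQ : itg (fun x => v x * Q x).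
  apply: (dom _ (4 / l0 ^+ 2)) => // x.
  by rewrite ger0_norm// mulr_ge0// expR_ge0.
have Q0 : 0 <= \int[F]_x (v x * Q x).
  by apply: Rintegral_ge0 => x _; rewrite mulr_ge0// mulr_ge0// expR_ge0.
exists (\int[F]_x (v x * Q x) + 1); first by rewrite ltr_wpDl.
move=> l ll0.
have ie : itg (fun x => v x * expR (l * (x - b))).
  apply: (dom _ 1) => //; first exact: measurable_expRM.
  move=> x; rewrite ger0_norm ?expR_ge0// mul1r ler_expR.
  apply: le_trans (ler_norm _) _; rewrite normrM ler_wpM2r//.
  by apply: le_trans ll0 _; lra.
rewrite wexp_Rintegral// lee_fin.
apply: (@le_trans _ _ (1 + (l * (\int[F]_x (v x * (x - b))) +
    l ^+ 2 * \int[F]_x (v x * Q x)))).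
  rewrite -v1 -!RintegralZl// -RintegralD//; try exact: itgZ.
  rewrite -RintegralD//; last by apply: itgD; exact: itgZ.
  apply: le_Rintegral => //.
    by apply: itgD => //; apply: itgD; exact: itgZ.
  move=> x _; rewrite [leRHS](_ : _ = v x * (1 + l * (x - b) + l ^+ 2 * Q x)); last by ring.
  rewrite ler_wpM2l//; apply: le_trans (expR_le_quad _) _; rewrite lerD2l.
  rewrite exprMn -mulrA ler_wpM2l ?sqr_ge0// /Q.
  have h1 : expR `|l * (x - b)| <= expR (l0 * `|x - b|).
    by rewrite ler_expR normrM ler_wpM2r.
  have lx0 : 0 <= l0 * `|x - b| by rewrite mulr_ge0// ltW.
  have h2 := sqr_le_expR lx0.
  rewrite -[(x - b) ^+ 2]real_normK ?num_real//.
  rewrite [leRHS]mulrAC ler_pdivlMr ?exprn_gt0//.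
  rewrite (_ : 2 * l0 * `|x - b| = l0 * `|x - b| + l0 * `|x - b|); last by ring.
  rewrite expRD [leRHS]mulrA mulrAC -exprMn [`|x - b| * l0]mulrC.
  by apply: ler_pM; rewrite ?sqr_ge0 ?expR_ge0.
apply: le_trans (expR_ge1Dx _) _; rewrite ler_expR lerD2l [leLHS]mulrC.
by rewrite ler_wpM2r ?sqr_ge0// lerDl.
Qed.

End exponential_moments.

(** * The tilted law and its decomposition *)

Section tilting.
Set Implicit Arguments.
Unset Strict Implicit.
Context {R : realType} (F : probability R R) (b th : R).
Hypotheses (mean_lt : mean F < b) (dom0 : interior (cgf_dom F) 0).
Hypotheses (dom_th : interior (cgf_dom F) th) (dcgf : is_derive th 1 (cgf F) b).

Let itg_near t0 : interior (cgf_dom F) t0 -> exists2 e : R, 0 < e &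
  forall t, `|t - t0| <= e -> itg F (fun x => expR (t * (x - b))).
Proof.
move=> /cgf_dom_nbhs[e e0 H]; exists e => // t te.
by have [] := mgf_shift b (H t te).
Qed.

Let itg_near_M t0 : interior (cgf_dom F) t0 ->
  itg F (fun x => (x - b) * expR (t0 * (x - b))).
Proof.
move=> /itg_near[e e0 H]; apply: (itg_shiftM e0); apply: H.
  by rewrite addrAC subrr add0r ger0_norm// ltW.
by rewrite addrAC subrr add0r normrN ger0_norm// ltW.
Qed.

Let itg_shift : itg F (fun x => x - b).
Proof.
have := itg_near_M dom0; congr itg; apply/funext => x.
by rewrite mul0r expR0 mulr1.
Qed.

Let mean_shift : \int[F]_x (x - b) = mean F - b.
Proof.
have -> : mean F = \int[F]_x ((x - b) + cst b x).
  by rewrite /mean /Rintegral; congr fine; apply: eq_integral => x _; rewrite subrK.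
rewrite [in RHS]RintegralD//; last exact: itg_cst.
have -> : \int[F]_x cst b x = b.
  rewrite Rintegral_cst// -[RHS]mulr1; congr (_ * _).
  exact: (congr1 fine (probability_setT F)).
by rewrite addrK.
Qed.

Let mean0 : \int[F]_x ((x - b) * expR (th * (x - b))) = 0.
Proof. exact: tilted_mean_eq0. Qed.

(** For [th <= 0] one has [y exp(th y) <= y] for every [y], so the tilted first moment, which is 0,
    would be at most [mean F - b < 0]. *)
Lemma tilt_gt0 : 0 < th.
Proof.
rewrite ltNge; apply/negP => th0.
have : \int[F]_x ((x - b) * expR (th * (x - b))) <= \int[F]_x (x - b).
  apply: le_Rintegral => //; first exact: itg_near_M.
  move=> x _; have [xb|xb] := leP 0 (x - b).
    by rewrite ler_piMr// -[leRHS]expR0 ler_expR mulr_le0_ge0.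
  have e1 : 1 <= expR (th * (x - b)) by rewrite -[leLHS]expR0 ler_expR mulr_le0// ltW.
  have : 0 <= - (x - b) * (expR (th * (x - b)) - 1).
    by rewrite mulr_ge0 ?subr_ge0// oppr_ge0 ltW.
  by lra.
rewrite mean0 mean_shift subr_ge0 leNgt.
by rewrite mean_lt.
Qed.

Let Rintegral_null (h1 h2 : R -> R) (S : set R) : measurable S -> F S = 0%E ->
  measurable_fun setT h1 -> measurable_fun setT h2 ->
  (forall x, ~ S x -> h1 x = h2 x) -> \int[F]_x h1 x = \int[F]_x h2 x.
Proof.
move=> mS S0 m1 m2 h12; rewrite /Rintegral; congr fine.
apply: ae_eq_integral => //; try exact/measurable_EFinP.
exists S; split => // x /=; apply: contra_notP => Sx _.
by rewrite h12.
Qed.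

Let mshift : measurable_fun setT (fun x : R => x - b).
Proof. exact: measurable_shift. Qed.

Let mexp : measurable_fun setT (fun x : R => expR (th * (x - b))).
Proof. exact: measurable_expRM. Qed.

(** Otherwise [(X - b) exp(th (X - b))] is almost surely nonpositive with integral 0, so [X = b]
    almost surely, against [mean F < b]. *)
Lemma mass_above_gt0 : (0 < F `]b, +oo[%classic)%E.
Proof.
rewrite lt0e measure_ge0 andbT; apply/negP => /eqP F0.
pose h x := `|x - b| * expR (th * (x - b)).
have mh : measurable_fun setT h.
  by apply: measurable_funM => //; apply: measurableT_comp.
have h0 : \int[F]_x h x = 0.
  have -> : \int[F]_x h x = \int[F]_x (-1 * ((x - b) * expR (th * (x - b)))).
    apply: (Rintegral_null _ F0) => //.
      by apply: measurable_funM => //; apply: measurable_funM.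
    move=> x /=; rewrite in_itv/= andbT => /negP; rewrite -leNgt => xb.
    by rewrite /h ler0_norm ?subr_le0// mulN1r mulNr.
  by rewrite RintegralZl ?mean0 ?mulr0//; exact: itg_near_M.
have ih : itg F h.
  apply: (le_integrable _ _ _ (itg_near_M dom_th)) => //.
    exact/measurable_EFinP.
  move=> x _; rewrite /= lee_fin /h !normrM normr_id//.
have mN : measurable [set x : R | x != b].
  rewrite (_ : [set _ | _] = ~` [set b]); last first.
    by apply/seteqP; split => x /= /eqP.
  by apply: measurableC; exact: measurable_set1.
have FN : F [set x : R | x != b] = 0%E.
  apply/eqP; rewrite eq_le measure_ge0 andbT leNgt; apply/negP => FN.
  have : 0 < \int[F]_x h x.
    apply: (Rintegral_gt0 ih _ mN FN) => x; first by rewrite mulr_ge0// expR_ge0.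
    by move=> /= xb; rewrite mulr_gt0 ?expR_gt0// normr_gt0 subr_eq0.
  by rewrite h0 ltxx.
have : \int[F]_x (x - b) = \int[F]_x cst 0 x.
  apply: (Rintegral_null mN FN) => // x /= /negP; rewrite negbK => /eqP ->.
  by rewrite subrr.
rewrite mean_shift Rintegral_cst// mul0r => /eqP; rewrite subr_eq0 => /eqP e.
by move: mean_lt; rewrite e ltxx.
Qed.

(** Countably many such intervals exhaust the half-line above [b]. The lower end, kept off [b], will
    give [B] a mean of at least [d]; the upper end bounds its steps. *)
Lemma mass_itv_gt0 : exists d K : R,
  [/\ 0 < d, d < K & (0 < F (`]b + d, b + K]%classic : set R)%R)%E].
Proof.
pose I n := `]b + n.+2%:R^-1, b + n.+1%:R]%classic : set R.
suff [n Fn] : exists n, (0 < F (I n))%E.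
  exists n.+2%:R^-1, n.+1%:R; split => //.
  by rewrite (@lt_le_trans _ _ 1) ?ler1n// invf_lt1// ltr1n.
apply: contrapT => /forallNP FI.
have := mass_above_gt0; apply/negP; rewrite -leNgt.
have -> : `]b, +oo[%classic = \bigcup_n I n.
  apply/seteqP; split => [x /=|x [n _]]; rewrite /I/= !in_itv/= ?andbT; last first.
    by move=> /andP[xb _]; apply: lt_trans xb; rewrite ltrDl.
  move=> xb; have y0 : 0 < x - b by rewrite subr_gt0.
  (* [n + 1] exceeds both [x - b] and its inverse, which yields the two endpoint conditions. *)
  pose n := Num.truncn ((x - b) + (x - b)^-1).
  have hn : (x - b) + (x - b)^-1 < n.+1%:R := truncnS_gt _.
  have yi0 : 0 < (x - b)^-1 by rewrite invr_gt0.
  exists n => //=; rewrite in_itv/=; apply/andP; split.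
    rewrite -ltrBrDl invf_plt ?posrE// (lt_trans _ (_ : n.+1%:R < n.+2%:R))//.
      by apply: lt_trans hn; rewrite ltrDr.
    by rewrite ltr_nat.
  by rewrite -lerBlDl ltW//; apply: lt_trans hn; rewrite ltrDl.
have : F.-negligible (\bigcup_n I n).
  apply: negligible_bigcup => n; apply/negligibleP => //.
    exact: measurable_itv.
  apply/eqP; rewrite eq_le measure_ge0 andbT leNgt; apply/negP; exact: FI.
move=> /negligibleP -> //.
by apply: bigcup_measurable => n _; exact: measurable_itv.
Qed.

(** The tilted density is split with [B] living on an interval above [b]; the neighbourhood of [th]
    in the domain supplies the moment bounds for both parts, and [iter_mix_comparison] applies. *)
Lemma tilted_comparison : exists2 C : R, 0 < C & exists N : nat,
  forall m, (N <= m)%N -> forall a,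
  let T := wconv F b (fun x =>
    (\int[F]_x expR (th * (x - b)))^-1 * expR (th * (x - b))) in
  fine (iter m T (EFin \o exp_tail th) a) <=
  C * fine (iter m.+1 T (EFin \o exp_tail th) 0).
Proof.
have th0 := tilt_gt0.
have [e e0 Hitg] := itg_near dom_th.
have i0 : itg F (fun x => expR (th * (x - b))).
  by apply: Hitg; rewrite subrr normr0 ltW.
have phi0 := Rintegral_expR_gt0 i0; set phi := \int[F]_x _ in phi0 *.
have phiV : 0 < phi^-1 by rewrite invr_gt0.
pose w x := phi^-1 * expR (th * (x - b)).
have w0 x : 0 < w x by rewrite mulr_gt0// expR_gt0.
have mw : measurable_fun setT w by exact: measurable_funM.
have iw : itg F w by exact: itgZ.
have w1 : \int[F]_x w x = 1 by rewrite RintegralZl// mulVf// gt_eqF.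
have iwy : itg F (fun x => w x * (x - b)).
  rewrite (_ : (fun _ => _) = fun x => phi^-1 * ((x - b) * expR (th * (x - b)))).
    exact/itgZ/itg_near_M.
  by apply/funext => x; rewrite /w mulrAC mulrA.
have wy : \int[F]_x (w x * (x - b)) = 0.
  under eq_Rintegral do rewrite /w -mulrA [expR _ * _]mulrC.
  by rewrite RintegralZl ?mean0 ?mulr0//; exact: itg_near_M.
have [d [K [d0 dK FI]]] := mass_itv_gt0.
set I := `]b + d, b + K]%classic in FI.
have mI : measurable I by exact: measurable_itv.
pose J : R -> R := \1_I.
have J01 x : 0 <= J x <= 1.
  by rewrite /J indicE; case: (x \in I); rewrite ?lexx ler01.
have J0 x : 0 <= J x by case/andP: (J01 x).
have J1 x : J x <= 1 by case/andP: (J01 x).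
have mJ : measurable_fun setT J by exact: measurable_indic.
have JI x : J x != 0 -> b + d < x <= b + K.
  rewrite /J indicE; case: (boolP (x \in I)) => [|_]; last by rewrite eqxx.
  by rewrite inE /I/= in_itv.
have iwJ : itg F (fun x => w x * J x).
  apply: (le_integrable _ _ _ iw) => //.
    by apply/measurable_EFinP; apply: measurable_funM.
  move=> x _ /=; rewrite lee_fin normrM (ger0_norm (J0 x)).
  by rewrite ler_piMr.
pose b0 := \int[F]_x (w x * J x).
have b00 : 0 < b0.
  apply: (@Rintegral_gt0 _ _ _ I) => //.
    by move=> x; rewrite mulr_ge0// ltW.
  by move=> x Ix; rewrite mulr_gt0// /J indicE mem_set.
have b01 : b0 <= 1.
  rewrite -w1; apply: le_Rintegral => // x _.
  by rewrite ler_piMr// ltW.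
(* B carries half of the tilted mass of I: q <= 1/2, and A stays nonnegative. *)
pose q := b0 / 2; pose p := 1 - q.
have q0 : 0 < q by rewrite divr_gt0.
have q2 : q <= 2^-1 by rewrite /q; lra.
have p0 : 0 < p by rewrite /p; lra.
have pq1 : p + q = 1 by rewrite /p subrK.
pose wB x := b0^-1 * (w x * J x).
pose wA x := p^-1 * (w x - 2^-1 * (w x * J x)).
have wJ x : w x * J x <= w x by rewrite ler_piMr// ltW.
have wJ0 x : 0 <= w x * J x by rewrite mulr_ge0// ltW.
have mwJ : measurable_fun setT (fun x => w x * J x) by exact: measurable_funM.
have wwB : weight wB.
  split; first exact: measurable_funM.
  by move=> x; rewrite mulr_ge0// invr_ge0 ltW.
have wwA : weight wA.
  split; first by apply: measurable_funM => //; apply: measurable_funB => //; apply: measurable_funM.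
  move=> x; rewrite mulr_ge0 ?invr_ge0 ?(ltW p0)//.
  by have := wJ x; have := wJ0 x; lra.
have wTE : (fun x => p * wA x + q * wB x) = w.
  by apply/funext => x; rewrite /wA /wB /q; field; rewrite !gt_eqF.
have IB : \int[F]_x wB x = 1 by rewrite RintegralZl// mulVf// gt_eqF.
have IA : \int[F]_x wA x = 1.
  rewrite RintegralZl//; last by apply: itgB => //; exact: itgZ.
  rewrite RintegralB//; last exact: itgZ.
  have -> : \int[F]_x (2^-1 * (w x * J x)) = q by rewrite RintegralZl// mulrC.
  by rewrite w1 mulVf// gt_eqF.
have wB_le x : wB x <= b0^-1 * phi^-1 * expR (th * (x - b)).
  by rewrite -mulrA ler_wpM2l// invr_ge0 ltW.
have wA_le x : wA x <= p^-1 * phi^-1 * expR (th * (x - b)).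
  rewrite -mulrA ler_wpM2l// ?invr_ge0 ?(ltW p0)// -/(w x).
  by have := wJ0 x; lra.
have l00 : 0 < e / 2 by rewrite divr_gt0.
have e2 : 2 * (e / 2) = e by rewrite mulrC divfK.
have i1 : itg F (fun x => expR ((th + 2 * (e / 2)) * (x - b))).
  by apply: Hitg; rewrite e2 addrAC subrr add0r ger0_norm// ltW.
have i2 : itg F (fun x => expR ((th - 2 * (e / 2)) * (x - b))).
  by apply: Hitg; rewrite e2 addrAC subrr add0r normrN ger0_norm// ltW.
have [iyA [CA CA0 mgfA]] := quadratic_mgf_bound wwA l00 wA_le IA i1 i2.
have [iyB [CB CB0 mgfB]] := quadratic_mgf_bound wwB l00 wB_le IB i1 i2.
set ybar := \int[F]_x (wA x * (x - b)) in mgfA.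
set zbar := \int[F]_x (wB x * (x - b)) in mgfB.
have yz : p * ybar + q * zbar = 0.
  rewrite -wy -wTE -!RintegralZl// -RintegralD//; try exact: itgZ.
  by apply: eq_Rintegral => x _; ring.
have zd : d <= zbar.
  rewrite -[leLHS]mulr1 -IB -RintegralZl//; last exact: itgZ.
  apply: le_Rintegral => //; first exact/itgZ/itgZ.
  move=> x _; rewrite /wB; have [->|Jx] := eqVneq (J x) 0.
    by rewrite !(mulr0, mul0r).
  have /andP[xd _] := JI x Jx.
  rewrite mulrC ler_wpM2l ?mulr_ge0 ?invr_ge0 ?(ltW b00)//; lra.
have z0 : 0 < zbar by exact: lt_le_trans zd.
(* [D] is the distance between the means of [B] and [A]; as the mixture is centred, these are [p D]
   and [- q D]. *)
pose D := zbar / p.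
have D0 : 0 < D by rewrite divr_gt0.
have yE : ybar = - (q * D).
  have -> : ybar = (p * ybar + q * zbar) / p - q * zbar / p by field; rewrite gt_eqF.
  by rewrite yz mul0r sub0r /D mulrA.
have zE : zbar = p * D by rewrite /D mulrC divfK// gt_eqF.
have itg_mul1 (g : R -> R) : itg F g -> itg F (fun x => g x * cst 1 x).
  by congr itg; apply/funext => x; rewrite /cst mulr1.
have wexpA1 : wexp F wA (cst 1) = 1%E.
  rewrite wexp_Rintegral.
    by congr EFin; rewrite -[RHS]IA; apply: eq_Rintegral => x _; rewrite mulr1.
  apply: itg_mul1.
  by apply: itgZ; apply: itgB => //; exact: itgZ.
have wexpB1 : wexp F wB (cst 1) = 1%E.
  rewrite wexp_Rintegral.
    by congr EFin; rewrite -[RHS]IB; apply: eq_Rintegral => x _; rewrite mulr1.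
  apply: itg_mul1.
  exact: itgZ.
have wBK x : wB x != 0 -> b < x <= b + K.
  rewrite /wB => wx; have /JI : J x != 0.
    by apply: contraNneq wx => ->; rewrite !mulr0.
  by move=> /andP[xd ->]; rewrite andbT (lt_trans _ xd)// ltrDl.
(* The density of [A] is at most a constant times [exp(th (x - b))], which the integrand cancels. *)
have wACA : (wexp F wA (fun x => expR (- th * (x - b))) <= (p^-1 * phi^-1)%:E)%E.
  apply: (@le_trans _ _ (\int[F]_x (cst (p^-1 * phi^-1)%:E x))%E); last first.
    rewrite integral_cst// -[leRHS]mule1 le_eqVlt; apply/orP; left; apply/eqP.
    by congr (_ * _)%E; exact: probability_setT.
  apply: ge0_le_integral => //.
  - move=> x _; rewrite lee_fin mulr_ge0 ?expR_ge0//; exact: wwA.2.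
  - apply/measurable_EFinP; apply: measurable_funM; first exact: wwA.1.
    exact: measurable_expRM.
  move=> x _; rewrite lee_fin mulNr expRN ler_pdivrMr ?expR_gt0//.
have mA l : `|l| <= e / 2 -> (wexp F wA (fun x => expR (l * (x - b))) <=
    (expR (- (l * q * D) + (CA + CB) * l ^+ 2))%:E)%E.
  move=> /mgfA le; apply: le_trans le _; rewrite lee_fin ler_expR yE mulrN mulrA.
  by rewrite lerD2l ler_wpM2r ?sqr_ge0// lerDl ltW.
have mB l : `|l| <= e / 2 -> (wexp F wB (fun x => expR (l * (x - b))) <=
    (expR (l * p * D + (CA + CB) * l ^+ 2))%:E)%E.
  move=> /mgfB le; apply: le_trans le _; rewrite lee_fin ler_expR zE mulrA.
  by rewrite lerD2l ler_wpM2r ?sqr_ge0// lerDr ltW.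
have CAB : 0 < CA + CB by rewrite addr_gt0.
have := iter_mix_comparison p0 q0 pq1 wwA wwB wexpA1 wexpB1 th0 l00 CAB D0
  wBK wACA mA mB.
by rewrite wTE.
Qed.

End tilting.

(** * Tail probabilities as iterated convolutions, and truncation *)

Section truncation.
Set Implicit Arguments.
Unset Strict Implicit.
Context {R : realType} (F : probability R R) (b : R).

Let H : R -> \bar R := EFin \o @step R.

Let nH : nonneg_meas H.
Proof. exact/nonneg_meas_EFin/weight_step. Qed.

Let w1 : weight (cst 1 : R -> R).
Proof. exact: weight_cst. Qed.

Definition below (u x : R) : R := \1_(`]-oo, u]%classic : set R) x.

Lemma below_01 u x : 0 <= below u x <= 1.
Proof. by rewrite /below indicE; case: (_ \in _); rewrite ?lexx ler01. Qed.

Lemma weight_below u : weight (below u).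
Proof.
split; last by move=> x; case/andP: (below_01 u x).
by apply: measurable_indic; exact: measurable_itv.
Qed.

Definition above (u x : R) : R := 1 - below u x.

Lemma weight_above u : weight (above u).
Proof.
split; first by apply: measurable_funB => //; case: (weight_below u).
by move=> x; rewrite subr_ge0; case/andP: (below_01 u x).
Qed.

Lemma above_le_expR (u t x : R) : 0 <= t -> above u x <= expR (t * (x - u)).
Proof.
move=> t0; rewrite /above /below indicE; have [|xu] := boolP (x \in _).
  by rewrite subrr expR_ge0.
rewrite subr0 -expR0 ler_expR mulr_ge0// subr_ge0 ltW//.
by move: xu; rewrite notin_setE/= in_itv/= => /negP; rewrite ltNge.
Qed.

(** Turns the restricted measure into a density against [F], the form that [wconv] handles. *)
Lemma integral_mrestr (D : set R) (mD : measurable D) (h : R -> \bar R) :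
  nonneg_meas h ->
  (\int[mrestr F mD]_x h x = \int[F]_x ((\1_D x)%:E * h x))%E.
Proof.
move=> [mh h0].
have mDC : measurable (~` D) by exact: measurableC.
rewrite -(setUv D) ge0_integral_setU//; last 2 first.
- by rewrite setUv.
- by apply/disj_setPCl => //; rewrite setCK.
rewrite [X in (_ + X)%E]null_set_integral ?adde0//; last 2 first.
- exact: measurable_funTS.
- by rewrite /= /mrestr setICl measure0.
rewrite (eq_measure_integral F); last first.
  by move=> A mA AD; rewrite /= /mrestr; congr (F _); exact/setIidPl.
rewrite [LHS]integral_mkcond setUv; apply: eq_integral => x _.
by rewrite patchE indicE; case: (x \in D); rewrite ?mul1e ?mul0e.
Qed.

(** Centring every step at [b] moves the threshold into the starting point, which is 0 for [s = 0]
    and [g = b k]. *)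
Lemma tail_iterE (g : R) k s :
  tail_iter F g k s = iter k (wconv F b (cst 1)) H (s + k%:R * b - g).
Proof.
elim: k s => [|k IH] s /=.
  rewrite /H /= /step !indicE; congr (nat_of_bool _)%:R%:E.
  by apply/idP/idP; rewrite !inE/= mul0r addr0 subr_gt0.
apply: eq_integral => x _; rewrite IH mul1e -natr1; congr (iter k _ _ _).
by ring.
Qed.

(** Each summand contributes the normalising factor once; what remains is the sub-probability kernel
    [below u]. *)
Lemma tail_iter_trunc (g u : R) k s :
  tail_iter (trunc F u) g k s =
  (((fine (F `]-oo, u]%classic))^-1 ^+ k)%R%:E *
    iter k (wconv F b (below u)) H (s + k%:R * b - g)%R)%E.
Proof.
elim: k s => [|k IH] s /=.
  rewrite expr0 mul1e /H /= /step !indicE; congr (nat_of_bool _)%:R%:E.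
  by apply/idP/idP; rewrite !inE/= mul0r addr0 subr_gt0.
set c := (fine _)^-1 in IH *.
have c0 : 0 <= c by exact: trunc_const_ge0.
set X := iter k _ H in IH *.
have nX : nonneg_meas X by exact: nonneg_meas_iter (weight_below u) nH.
set s' := s + _ - g.
have -> : (fun x => tail_iter (trunc F u) g k (s + x)) =
    (fun x => (c ^+ k)%:E * X (s' + (x - b))%R)%E.
  apply/funext => x; rewrite IH; congr (_ * X _)%E.
  by rewrite /s' -natr1; ring.
have ck0 : 0 <= c ^+ k by rewrite exprn_ge0.
have nh := nonneg_measZ ck0 nX.
have nh' : nonneg_meas (fun x => (c ^+ k)%:E * X (s' + (x - b))%R)%E.
  split; last by move=> x; exact: nh.2.
  exact: (nonneg_meas_shift b s' nh).
rewrite /trunc ge0_integral_mscale//; last 2 first.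
- exact: nh'.1.
- by move=> x _; exact: nh'.2.
rewrite integral_mrestr// exprS EFinM -muleA; congr (_ * _)%E.
exact: (wconvZ F b s' ck0 (weight_below u) nX).
Qed.

(** Exponential change of measure: [k] tilted steps from [s] to [S] carry the density
    [phi^-k exp(th (S - s))], which the prefactor and the damping [exp(-th S)] in [exp_tail]
    cancel. *)
Lemma iter_wconv_tilt (th phi : R) k s : 0 < phi ->
  iter k (wconv F b (cst 1)) H s =
  ((phi ^+ k * expR (th * s))%R%:E *
   iter k (wconv F b (fun x => phi^-1 * expR (th * (x - b)))%R)
     (EFin \o exp_tail th) s)%E.
Proof.
move=> phi0; elim: k s => [|k IH] s /=.
  by rewrite -EFinM expr0 mul1r /exp_tail mulrA -expRD subrr expR0 mul1r.
set w := fun x => _; set X := iter k _ _ in IH *; set Y := iter k _ _ in IH *.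
have ww : weight w.
  split; first by apply: measurable_funM => //; case: (weight_expR th b).
  by move=> x; rewrite mulr_ge0 ?expR_ge0// invr_ge0 ltW.
have nY : nonneg_meas Y.
  exact/(nonneg_meas_iter F b k ww)/nonneg_meas_EFin/weight_exp_tail.
have c0 : 0 <= phi ^+ k.+1 * expR (th * s).
  by rewrite mulr_ge0 ?expR_ge0// exprn_ge0// ltW.
rewrite -(wconvZ F b s c0 ww nY); apply: eq_integral => x _.
rewrite mul1e IH !muleA -!EFinM; congr (_%:E * _)%E.
rewrite /w mulrDr expRD exprS.
by field; rewrite gt_eqF.
Qed.

Let le1 t : (H t <= 1%:E)%E.
Proof. by rewrite lee_fin; case/andP: (step_01 t). Qed.

Local Notation P := (wconv F b (cst 1)).
Local Notation Pu u := (wconv F b (below u)).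
Local Notation Qu u := (wconv F b (above u)).

Let wexp1 : wexp F (cst 1) (cst 1) = 1%E.
Proof.
rewrite /wexp; under eq_integral do rewrite /cst mulr1.
by rewrite integral_cst// mul1e; exact: probability_setT.
Qed.

(* Truncating the summands one at a time; since convolutions commute, the single
   summand above u can always be moved to the front. *)
Lemma iter_truncate (u : R) n s :
  (iter n P H s <= iter n (Pu u) H s + n%:R%:E * Qu u (iter n.-1 P H) s)%E.
Proof.
have wu := weight_below u; have wa := weight_above u.
have nP n' : nonneg_meas (iter n' P H) by exact: nonneg_meas_iter.
have nPu n' : nonneg_meas (iter n' (Pu u) H) by exact: nonneg_meas_iter.
have nQ n' : nonneg_meas (Qu u (iter n' P H)) by exact: nonneg_meas_wconv.
have PE g t : nonneg_meas g -> (P g t = Pu u g t + Qu u g t)%E.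
  move=> ng; have := wconvDl F b t ler01 ler01 wu wa ng.
  rewrite !mul1e => <-; congr (wconv F b _ g t); apply/funext => x.
  by rewrite !mul1r /above addrC subrK.
elim: n s => [|n IH] s; first by rewrite mul0e adde0.
rewrite [leLHS]PE; last exact: nP.
have n0 : (0 <= n%:R :> R) by [].
have -> : (n.+1%:R%:E * Qu u (iter n P H) s =
    n%:R%:E * Qu u (iter n P H) s + Qu u (iter n P H) s)%E.
  rewrite -natr1 EFinD ge0_muleDl ?lee_fin// mul1e//.
set q := Qu u (iter n P H) s; rewrite [leRHS]addeA; apply: leeD2r.
rewrite {}/q -[X in (Pu u X s <= _)%E]/(iter n P H).
have nX := nonneg_measZ n0 (nQ n.-1).
apply: le_trans.
  apply: (@le_wconv _ F b _ _ _ wu (nP n) (nonneg_measD (nPu n) nX)).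
  exact: IH.
rewrite (wconvD F b s wu (nPu n) nX) (wconvZ F b s n0 wu (nQ n.-1)).
(* For [n = 0] the predecessor is 0 as well, but the coefficient 0 removes the term. *)
apply: leeD2l; case: n {IH nX} n0 => [|n] n0; first by rewrite !mul0e.
apply: lee_wpmul2l; first by rewrite lee_fin.
(* The large jump passes to the front, and the truncated step behind it is bounded by a full one. *)
rewrite -[n.+1.-1]/n (wconvC F b wu wa (nP n)).
apply: (@le_wconv _ F b _ _ _ wa (nonneg_meas_wconv F b wu (nP n)) (nP n.+1)).
apply: (@le_wconvl _ F b _ _ _ wu w1 (nP n)).
by move=> x; case/andP: (below_01 u x).
Qed.

Lemma le_iter_below (u : R) n s : (iter n (Pu u) H s <= iter n P H s)%E.
Proof.
elim: n s => [|n IH] s; first exact: lexx.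
rewrite !iterS.
have nP : nonneg_meas (iter n P H) by exact: nonneg_meas_iter.
have nPu : nonneg_meas (iter n (Pu u) H).
  by apply: nonneg_meas_iter => //; exact: weight_below.
apply: le_trans.
  by apply: (le_wconv F b (weight_below u) nPu nP); exact: IH.
apply: (@le_wconvl _ F b _ _ _ (weight_below u) w1 nP).
by move=> x; case/andP: (below_01 u x).
Qed.

Lemma iter_fin_num (n : nat) s : iter n P H s \is a fin_num.
Proof.
rewrite ge0_fin_numE; last by have [_] := nonneg_meas_iter F b n w1 nH; exact.
by rewrite (le_lt_trans (iter_wconv_le_cst b n s w1 wexp1 nH le1))// ltry.
Qed.

Lemma iter_below_fin_num (u : R) (n : nat) s : iter n (Pu u) H s \is a fin_num.
Proof.
rewrite ge0_fin_numE; last first.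
  by have [_] := nonneg_meas_iter F b n (weight_below u) nH; exact.
by rewrite (le_lt_trans (le_iter_below u n s))// ltey_eq iter_fin_num.
Qed.

Lemma psumE n : psum F n (b * n%:R) = fine (iter n P H 0).
Proof.
rewrite /psum tail_iterE (_ : 0 + n%:R * b - b * n%:R = 0)//.
by ring.
Qed.

Lemma psum_truncE u n : psum (trunc F u) n (b * n%:R) =
  (fine (F `]-oo, u]%classic))^-1 ^+ n * fine (iter n (Pu u) H 0).
Proof.
rewrite /psum tail_iter_trunc (_ : 0 + n%:R * b - b * n%:R = 0); last by ring.
by rewrite fineM// iter_below_fin_num.
Qed.

Lemma psum_ge0 n : 0 <= psum F n (b * n%:R).
Proof.
rewrite psumE fine_ge0//.
by have [_] := nonneg_meas_iter F b n w1 nH; exact.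
Qed.

Lemma iter_below_ge0 u n : 0 <= fine (iter n (Pu u) H 0).
Proof.
rewrite fine_ge0//.
by have [_] := nonneg_meas_iter F b n (weight_below u) nH; exact.
Qed.

Lemma iter_below_le_psum u n : fine (iter n (Pu u) H 0) <= psum F n (b * n%:R).
Proof.
rewrite psumE; apply: fine_le; [exact: iter_below_fin_num|exact: iter_fin_num|].
exact: le_iter_below.
Qed.

Lemma psum_le_truncate u m : psum F m.+1 (b * m.+1%:R) <=
  fine (iter m.+1 (Pu u) H 0) + m.+1%:R * fine (Qu u (iter m P H) 0).
Proof.
have nP : nonneg_meas (iter m P H) by exact: nonneg_meas_iter.
have wa := weight_above u.
have Qfin : Qu u (iter m P H) 0 \is a fin_num.
  have [_ nQ] := nonneg_meas_wconv F b wa nP.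
  rewrite ge0_fin_numE; last exact: nQ.
  apply: (@le_lt_trans _ _ (P (iter m P H) 0)); last first.
    by rewrite -iterS ltey_eq iter_fin_num.
  apply: (@le_wconvl _ F b _ _ _ wa w1 nP).
  by move=> y; rewrite /above /cst gerBl; case/andP: (below_01 u y).
have fine_leDM (x y z : \bar R) (k : R) : x \is a fin_num -> y \is a fin_num ->
    z \is a fin_num -> (x <= y + k%:E * z)%E -> fine x <= fine y + k * fine z.
  by case: x => // x; case: y => // y; case: z => // z.
rewrite psumE; apply: fine_leDM Qfin _; first exact: iter_fin_num.
  exact: iter_below_fin_num.
exact: (iter_truncate u m.+1 0).
Qed.

(** Here [t] is the probability of [S_n > b n] with all summands at most [u], before normalisation;
    a union bound over the summand exceeding [u] separates it from the full probability. *)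
Lemma psum_trunc_bounds u m (q : R) :
  fine (Qu u (iter m P H) 0) <= q -> exists t : R,
  [/\ psum (trunc F u) m.+1 (b * m.+1%:R) =
        (fine (F `]-oo, u]%classic))^-1 ^+ m.+1 * t,
      0 <= t, t <= psum F m.+1 (b * m.+1%:R) &
      psum F m.+1 (b * m.+1%:R) <= t + m.+1%:R * q].
Proof.
move=> Qq; exists (fine (iter m.+1 (Pu u) H 0)); split.
- exact: psum_truncE.
- exact: iter_below_ge0.
- exact: iter_below_le_psum.
- by apply: le_trans (psum_le_truncate u m) _; apply: lerD => //; apply: ler_wpM2l.
Qed.

End truncation.

(** * Relative error of the truncated probability *)

Section truncation_error.
Set Implicit Arguments.
Unset Strict Implicit.
Context {R : realType} (F : probability R R) (b th th' : R).
Hypotheses (mean_lt : mean F < b) (dom0 : interior (cgf_dom F) 0).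
Hypotheses (dom_th : interior (cgf_dom F) th) (dcgf : is_derive th 1 (cgf F) b).
Hypotheses (th'0 : 0 < th') (dom_th' : cgf_dom F (th + th')).

Let th0 : 0 < th. Proof. exact: tilt_gt0. Qed.

Let H : R -> \bar R := EFin \o @step R.
Let phi := \int[F]_x expR (th * (x - b)).
Let phi' := \int[F]_x expR ((th + th') * (x - b)).

Let itg_th : itg F (fun x => expR (th * (x - b))).
Proof. by have [] := mgf_shift b (interior_subset dom_th). Qed.

Let itg_th' : itg F (fun x => expR ((th + th') * (x - b))).
Proof. by have [] := mgf_shift b dom_th'. Qed.

Let phi0 : 0 < phi. Proof. exact: Rintegral_expR_gt0. Qed.
Let phi'0 : 0 < phi'. Proof. exact: Rintegral_expR_gt0. Qed.

Let damp u := expR (th' * b) * expR (- (th' * u)).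

Let damp0 u : 0 < damp u. Proof. by rewrite mulr_gt0 ?expR_gt0. Qed.

Let expR_damp u x : expR (th' * (x - u)) = damp u * expR (th' * (x - b)).
Proof. by rewrite /damp -!expRD; congr expR; ring. Qed.

(** Markov's inequality with rate [th'], then [exp(th' y) <= 1 + exp((th + th') y)], which uses
    [th > 0]. *)
Lemma mass_above_le u :
  1 - fine (F `]-oo, u]%classic) <= (1 + phi') * damp u.
Proof.
have mI : measurable (`]-oo, u]%classic : set R) by exact: measurable_itv.
have ib : itg F (below u) by apply: integrable_indic.
have ia : itg F (above u) by exact: (itgB (itg_cst F 1) ib).
have -> : 1 - fine (F `]-oo, u]%classic) = \int[F]_x above u x.
  rewrite /above RintegralB//; last exact: itg_cst.
  congr (_ - _).
    rewrite Rintegral_cst// mul1r.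
    exact/esym/(congr1 fine (probability_setT F)).
  by rewrite /Rintegral /below integral_indic// setIT.
have -> : (1 + phi') * damp u =
    \int[F]_x (damp u * (cst 1 x + expR ((th + th') * (x - b)))).
  have ic := itg_cst F 1.
  rewrite RintegralZl//; last exact: itgD.
  rewrite RintegralD// Rintegral_cst// mul1r mulrC; congr (_ * (_ + _)).
  exact/esym/(congr1 fine (probability_setT F)).
apply: le_Rintegral => //.
  by apply: itgZ; apply: itgD => //; exact: itg_cst.
move=> x _; apply: le_trans (above_le_expR u x (ltW th'0)) _.
rewrite expR_damp ler_wpM2l ?(ltW (damp0 u))// /cst.
have [xb|xb] := leP (x - b) 0.
  apply: (@le_trans _ _ 1); last by rewrite lerDl expR_ge0.
  by rewrite -[leRHS]expR0 ler_expR mulr_ge0_le0// ltW.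
apply: (@le_trans _ _ (expR ((th + th') * (x - b)))); last by rewrite lerDr.
by rewrite ler_expR ler_wpM2r ?(ltW xb)// lerDr ltW.
Qed.

Let w x := phi^-1 * expR (th * (x - b)).
Local Notation T := (wconv F b w).
Local Notation P := (wconv F b (cst 1)).

Let ww : weight w.
Proof.
split; first by apply: measurable_funM => //; case: (weight_expR th b).
by move=> x; rewrite mulr_ge0 ?expR_ge0// invr_ge0 ltW.
Qed.

Let f := EFin \o exp_tail th.

Let nf : nonneg_meas f.
Proof. exact/nonneg_meas_EFin/weight_exp_tail. Qed.

Let tilt_fin n s : iter n T f s \is a fin_num.
Proof.
have w1 : wexp F w (cst 1) = 1%E.
  have e : (fun x => w x * cst 1 x) = w by apply/funext => x; rewrite /cst mulr1.
  rewrite wexp_Rintegral e; last exact: itgZ.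
  by rewrite RintegralZl// mulVf// gt_eqF.
rewrite ge0_fin_numE; last by have [_] := nonneg_meas_iter F b n ww nf; exact.
rewrite (@le_lt_trans _ _ 1%:E) ?ltry//.
apply: (iter_wconv_le_cst b n s ww w1 nf) => t.
by rewrite lee_fin exp_tail_le1 ?(ltW th0).
Qed.

(** A first jump [x > u] leaves m summands started at [x - b]. After tilting, [tilted_comparison]
    bounds them uniformly in [x], and the first jump contributes [E[exp(th (X - b)); X > u] <= damp
    u * phi']. *)
Lemma above_iter_le : exists2 C : R, 0 < C & exists N : nat,
  forall m, (N <= m)%N -> forall u,
  fine (wconv F b (above u) (iter m P H) 0) <=
  C * damp u * psum F m.+1 (b * m.+1%:R).
Proof.
have [C C0 [N hN]] := tilted_comparison mean_lt dom0 dom_th dcgf.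
(* The division by [phi] comes from comparing m summands with m + 1, each carrying one factor
   [phi]. *)
exists (C * phi' / phi); first by rewrite divr_gt0// mulr_gt0.
exists N => m mN u; rewrite psumE.
pose tp := fine (iter m.+1 P H 0).
pose S := C * fine (iter m.+1 T f 0).
have tpE : tp = phi ^+ m.+1 * fine (iter m.+1 T f 0).
  by rewrite /tp (iter_wconv_tilt F b th m.+1 0 phi0) mulr0 expR0 mulr1 fineM.
have S0 : 0 <= S.
  rewrite mulr_ge0 ?(ltW C0)// fine_ge0//.
  by have [_] := nonneg_meas_iter F b m.+1 ww nf; exact.
pose k := phi ^+ m * S * damp u.
have k0 : 0 <= k by rewrite mulr_ge0 ?(ltW (damp0 u))// mulr_ge0// exprn_ge0// ltW.
have wa := weight_above u.
have nP : nonneg_meas (iter m P H).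
  by apply: nonneg_meas_iter; [exact: weight_cst|exact/nonneg_meas_EFin/weight_step].
have ik : itg F (fun x => k * expR ((th + th') * (x - b))) by exact: itgZ.
have le : (wconv F b (above u) (iter m P H) 0 <= (k * phi')%:E)%E.
  have -> : (k * phi')%:E = (\int[F]_x (k * expR ((th + th') * (x - b)))%R%:E)%E.
    rewrite -RintegralZl// /Rintegral fineK//; exact: integrable_fin_num.
  apply: ge0_le_integral => //.
  - by move=> x _; exact: wconv_integrand_ge0.
  - exact: measurable_wconv_integrand.
  - by apply/measurable_EFinP; exact: (itg_measurable ik).
  move=> x _; rewrite (iter_wconv_tilt F b th m _ phi0) add0r.
  have fx : (iter m T f (x - b)%R <= S%:E)%E.
    by rewrite -(fineK (tilt_fin m (x - b))) lee_fin; exact: hN.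
  have c0 : 0 <= phi ^+ m * expR (th * (x - b)).
    by rewrite mulr_ge0 ?expR_ge0// exprn_ge0// ltW.
  apply: (@le_trans _ _ ((above u x)%:E *
      ((phi ^+ m * expR (th * (x - b)))%R%:E * S%:E))%E).
    by rewrite lee_wpmul2l ?lee_fin; [|exact: wa.2|rewrite lee_wpmul2l].
  rewrite -!EFinM lee_fin.
  rewrite [leLHS](_ : _ =
    phi ^+ m * S * expR (th * (x - b)) * above u x); last by ring.
  rewrite [leRHS](_ : _ =
    phi ^+ m * S * expR (th * (x - b)) * expR (th' * (x - u))); last first.
    by rewrite expR_damp mulrDl expRD /k; ring.
  rewrite ler_wpM2l ?above_le_expR ?(ltW th'0)//.
  by rewrite mulr_ge0 ?expR_ge0// mulr_ge0// exprn_ge0// ltW.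
have nQ := nonneg_meas_wconv F b wa nP.
have Qfin : wconv F b (above u) (iter m P H) 0 \is a fin_num.
  by rewrite ge0_fin_numE; [rewrite (le_lt_trans le)// ltry|exact: nQ.2].
rewrite -lee_fin fineK//; apply: le_trans le _; rewrite lee_fin -/tp tpE /k /S.
rewrite le_eqVlt; apply/orP; left; apply/eqP.
by rewrite exprS; field; rewrite gt_eqF.
Qed.

Lemma bernoulli_le (a : R) n : 0 <= a <= 1 -> 1 - n%:R * (1 - a) <= a ^+ n.
Proof.
move=> /andP[a0 a1]; elim: n => [|n IH]; first by rewrite mul0r subr0 expr0.
rewrite exprS; apply: (@le_trans _ _ (a * (1 - n%:R * (1 - a)))).
  rewrite -natr1 -subr_ge0 (_ : _ - _ = n%:R * (1 - a) ^+ 2); last by ring.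
  by rewrite mulr_ge0// sqr_ge0.
by rewrite ler_wpM2l.
Qed.

(** Two errors of opposite sign: normalisation multiplies by [F(u)^-n], and the removal of jumps
    above [u] loses mass. Each is at most a multiple of [n exp(-th' u)] times the full
    probability. *)
Lemma truncation_error : exists2 K : R, 0 < K & exists N : nat,
  forall n u, (N <= n)%N -> n%:R * expR (- (th' * u)) <= K^-1 ->
  `|psum (trunc F u) n (b * n%:R) - psum F n (b * n%:R)| <=
    K * (n%:R * expR (- (th' * u))) * psum F n (b * n%:R).
Proof.
have [C C0 [N hN]] := above_iter_le.
have eb0 := expR_gt0 (th' * b).
(* The factor 2 is that of [1 / (1 - x) <= 1 + 2 x] for [x = n (1 - F(u)) <= 1/2]; the smallness of
   [n exp(-th' u)] gives this range of [x]. *)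
pose C1 := 2 * ((1 + phi') * expR (th' * b)).
pose C2 := C * expR (th' * b).
have C10 : 0 < C1 by rewrite !mulr_gt0// addr_gt0.
have C20 : 0 < C2 by rewrite mulr_gt0.
have K0 : 0 < C1 + C2 by rewrite addr_gt0.
exists (C1 + C2) => //; exists N.+1 => -[//|m] u mN nE.
set n := m.+1 in nE *; set E := expR (- (th' * u)) in nE *.
have E0 : 0 < E by exact: expR_gt0.
have n1 : 1 <= n%:R :> R by rewrite ler1n.
set a := fine (F `]-oo, u]%classic).
have a0 : 0 <= a by rewrite fine_ge0// measure_ge0.
have a1 : a <= 1.
  by rewrite -lee_fin fineK ?probability_le1//; exact: fin_num_measure.
have hx : n%:R * (1 - a) <= C1 / 2 * (n%:R * E).
  rewrite mulrCA ler_wpM2l//.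
  apply: le_trans (mass_above_le u) _; rewrite /C1 /damp -/E.
  by rewrite le_eqVlt; apply/orP; left; apply/eqP; field.
have hx2 : C1 / 2 * (n%:R * E) <= 2^-1.
  apply: (@le_trans _ _ (C1 / 2 * (C1 + C2)^-1)).
    by rewrite ler_wpM2l// divr_ge0// ltW.
  rewrite mulrAC -[leRHS]mul1r ler_wpM2r// ler_pdivrMr// mul1r lerDl ltW//.
set x := n%:R * (1 - a) in hx.
have x0 : 0 <= x by rewrite mulr_ge0// subr_ge0.
have ax : 1 - x <= a ^+ n by apply: bernoulli_le; rewrite a0.
have an0 : 0 < a ^+ n by lra.
have an1 : a ^+ n <= 1 by rewrite exprn_ile1.
have inv_le : a^-1 ^+ n - 1 <= 2 * x.
  rewrite exprVn lerBlDr -div1r ler_pdivrMr//.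
  apply: (@le_trans _ _ ((2 * x + 1) * (1 - x))).
    have : 0 <= x * (1 - 2 * x) by rewrite mulr_ge0//; lra.
    by lra.
  by rewrite ler_wpM2l//; lra.
have inv_ge : 1 <= a^-1 ^+ n by rewrite exprVn invf_ge1.
have [tu [-> tu0 tutp tptuQ]] := psum_trunc_bounds (hN m mN u).
rewrite -/a -/n in tu0 tutp tptuQ *.
move: (psum F n _) tutp tptuQ => tp tutp tptuQ.
have tp0 : 0 <= tp by exact: le_trans tutp.
have tptu : tp - tu <= C2 * (n%:R * E) * tp.
  move: tptuQ; rewrite (_ : n%:R * (C * damp u * tp) = C2 * (n%:R * E) * tp); last first.
    by rewrite /C2 /damp -/E; ring.
  by lra.
have h1 : (a^-1 ^+ n - 1) * tu <= C1 * (n%:R * E) * tp.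
  apply: ler_pM => //; first by rewrite subr_ge0.
  by lra.
have h2 : 0 <= (a^-1 ^+ n - 1) * tu by rewrite mulr_ge0// subr_ge0.
rewrite (_ : a^-1 ^+ n * tu - tp = (a^-1 ^+ n - 1) * tu - (tp - tu)); last by ring.
by rewrite ler_norml; apply/andP; split; lra.
Qed.

End truncation_error.

(** * Passage to the limit *)

Theorem theorem3 (R : realType) (F : probability R R) (b : R) (u : nat -> R)
  (thetastar : R) :
  mean F < b ->
  (lattice F /\ (0 < F [set b])%E /\ (F [set b] < 1)%E) \/ ~ lattice F ->
  interior (cgf_dom F) 0 ->
  interior (cgf_dom F) thetastar ->
  is_derive thetastar 1 (cgf F) b ->
  (forall t, interior (cgf_dom F) t -> is_derive t 1 (cgf F) b -> t = thetastar) ->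
  (exists theta' : R, 0 < theta' /\ interior (cgf_dom F) (thetastar + theta') /\
     (fun n : nat => n%:R * expR (- (theta' * u n))) @ \oo --> 0) ->
  (fun n : nat => psum (trunc F (u n)) n (b * n%:R) - psum F n (b * n%:R))
    =o_\oo (fun n : nat => psum F n (b * n%:R)).
Proof.
move=> mean_lt _ dom0 dom_th dcgf _ [th' [th'0 [dom_th' un0]]].
have [K K0 [N hN]] :=
  truncation_error mean_lt dom0 dom_th dcgf th'0 (interior_subset dom_th').
apply/eqoP => e /= e0.
(* The first bound meets the smallness condition of [truncation_error]; the second makes the
   relative error at most [e]. *)
have d0 : 0 < Num.min K^-1 (e / K) by rewrite lt_min invr_gt0 K0 divr_gt0.
near=> n.
have nE : n%:R * expR (- (th' * u n)) < Num.min K^-1 (e / K).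
  have : `|0 - n%:R * expR (- (th' * u n))| < Num.min K^-1 (e / K).
    by near: n; move/cvgrPdist_lt : un0; exact.
  by rewrite sub0r normrN ger0_norm// mulr_ge0// expR_ge0.
move: nE; rewrite lt_min => /andP[n1 n2].
have Nn : (N <= n)%N by near: n; exact: nbhs_infty_ge.
apply: le_trans (hN n (u n) Nn (ltW n1)) _.
apply: ler_pM => //.
- by rewrite mulr_ge0 ?(ltW K0)// mulr_ge0// expR_ge0.
- exact: psum_ge0.
- by rewrite mulrC -ler_pdivlMr// ltW.
- exact: ler_norm.
Unshelve. all: by end_near.
Qed.
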